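(* Let $G_1$ be a finite connected oriented graph with distinguished vertices $a_1,b_1$ such that $d_1(a_1,b_1)>1$ and there exist at least two edge-disjoint paths connecting $a_1$ to $b_1$ in $G_1$. Let $\bar G_\infty=(G_\infty,E_\infty)$ be the Benjamini–Schramm limit of the hierarchical graphs with seed $G_1$, and let $$p_c(\bar G_\infty)=\sup\{p\in[0,1]:\theta^{\bar G_\infty}(p)=0\}.$$ Then $p_c(\bar G_\infty)$ is almost surely constant under the law of $\bar G_\infty$, and it coincides with $p_\star=p_\star(G_1)$, the unique fixed point in $(0,1)$ of the crossing probability function $f_1$ of $G_1$.
   Context: $G_1=(V_1,\mathcal E_1)$ is a finite connected oriented graph (a finite simple graph with an orientation chosen for each edge), with two distinguished vertices $a_1,b_1$. Orientations are used only to define the replacement operation below; distances, paths and connectivity ignore orientation. $d_1$ is the graph distance in $G_1$. Hierarchical graphs: $G_0$ is a single oriented edge $(a_0,b_0)$. Given $G_k=(V_k,\mathcal E_k)$ with distinguished vertices $a_k,b_k$, $G_{k+1}$ is obtained by replacing each oriented edge $(x,y)\in\mathcal E_k$ by a fresh copy of $G_1$, with $a_1$ identified with $x$ and $b_1$ with $y$; $a_{k+1},b_{k+1}$ are the vertices that were $a_k,b_k$. $f_1(p)$ is the probability that $a_1$ and $b_1$ are joined by an open path in $G_1$ when edges are independently open with probability $p$. Under the stated hypothesis on $G_1$, $f_1$ has exactly one fixed point $p_\star$ in $(0,1)$. Benjamini–Schramm limit: let $\mathcal G$ be the space of connected, locally finite edge-rooted graphs (orientations forgotten) up to root-preserving isomorphism,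 with metric $d(\bar G,\bar G')=\inf\{1/(r+1):\bar G|_r\cong\bar G'|_r\}$, where $\bar G|_r$ is the rooted subgraph induced by vertices within distance $r$ of an endpoint of the root edge. With $E_k$ uniform in $\mathcal E_k$, the random elements $(G_k,E_k)$ converge in distribution in $\mathcal G$; the limit is the random edge-rooted infinite graph $\bar G_\infty=(G_\infty,E_\infty)$. Percolation on $\bar G_\infty$: given $\bar G_\infty$, under $\mathbf P_p^{\bar G_\infty}$ each edge of $G_\infty$ is independently open with probability $p$. $\theta^{\bar G_\infty}(p)=\mathbf P_p^{\bar G_\infty}(E_\infty\leftrightarrow\infty)$ is the probability that some endpoint of $E_\infty$ lies in an infinite open cluster. *)

(* Defs.v *)
From HB Require Import structures.
From mathcomp Require Import all_boot all_order all_algebra.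
From mathcomp Require Import generic_quotient.
From mathcomp Require Import all_classical all_reals all_analysis.
From mathcomp Require Import measurable_realfun.

Set Implicit Arguments.
Unset Strict Implicit.
Unset Printing Implicit Defensive.

Import Order.TTheory GRing.Theory Num.Theory.
Import numFieldNormedType.Exports.

Local Open Scope classical_set_scope.
Local Open Scope ring_scope.

Definition walk (T : eqType) (e : rel T) (x y : T) (p : seq T) : bool :=
  path e x p && (last x p == y).

(* The minimum is taken over walks. The value is [0] if [y] is not reachable
   from [x], which never happens below, where all graphs are connected. *)
Definition gdist (T : eqType) (e : rel T) (x y : T) : nat :=
  if pselect (exists n, `[< exists2 p, walk e x y p & size p = n >]) is left h
  then ex_minn h else 0%N.

Lemma gdist_le (T : eqType) (e : rel T) (x y : T) p :
  walk e x y p -> (gdist e x y <= size p)%N.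
Proof.
move=> wp; rewrite /gdist; case: pselect => [h|//].
by case: ex_minnP => m _; apply; apply/asboolP; exists p.
Qed.

Lemma gdist_walk (T : eqType) (e : rel T) (x y : T) p :
  walk e x y p -> exists2 q, walk e x y q & size q = gdist e x y.
Proof.
move=> wp; rewrite /gdist; case: pselect => [h|nh].
  by case: ex_minnP => m /asboolP.
by exfalso; apply: nh; exists (size p); apply/asboolP; exists p.
Qed.

Record ograph := OGraph {
  overt : finType;
  oarc : rel overt;
  osrc : overt;
  otgt : overt;
  osrc_neq_otgt : osrc != otgt;
  oarc_asym : forall x y, oarc x y -> ~~ oarc y x;
  oarc_connected :
    forall x y, connect [rel u v | oarc u v || oarc v u] x y
}.

Definition oadj (G : ograph) : rel (overt G) :=
  [rel u v | oarc u v || oarc v u].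

Definition oedge (G : ograph) := {e : overt G * overt G | oarc e.1 e.2}.

Lemma oarc_neq (G : ograph) (x y : overt G) : oarc x y -> x != y.
Proof.
by apply: contraTneq => ->; apply/negP => yy; have /negP := oarc_asym yy.
Qed.

Lemma oadj_sym (G : ograph) : symmetric (@oadj G).
Proof. by move=> x y; rewrite /oadj /= orbC. Qed.

Section Replace.
Variables G H : ograph.

Definition inner := {w : overt H | (w != osrc H) && (w != otgt H)}.

Definition rvtx : finType := (overt G + oedge G * inner)%type.

(* [place e w] is the vertex [w] of the copy of [H] that replaces [e]. *)
Definition place (e : oedge G) (w : overt H) : rvtx :=
  if insub w is Some w' then inr (e, w')
  else inl (if w == osrc H then (val e).1 else (val e).2).

Definition rarc : rel rvtx := fun u v =>
  [exists e : oedge G, exists f : oedge H,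
     (place e (val f).1 == u) && (place e (val f).2 == v)].

Lemma rarcP u v :
  reflect (exists e w w', [/\ oarc w w', place e w = u & place e w' = v])
          (rarc u v).
Proof.
apply: (iffP existsP) => [[e /existsP[f /andP[/eqP fu /eqP fv]]]|].
  by exists e, (val f).1, (val f).2; split => //; exact: (valP f).
case=> e [w [w' [ww' wu wv]]]; exists e; apply/existsP.
by exists (exist _ (w, w') ww'); rewrite /= wu wv !eqxx.
Qed.

Lemma place_src e : place e (osrc H) = inl (val e).1.
Proof. by rewrite /place insubF ?eqxx. Qed.

Lemma place_tgt e : place e (otgt H) = inl (val e).2.
Proof.
by rewrite /place insubF ?eqxx ?andbF// eq_sym (negbTE (osrc_neq_otgt H)).
Qed.

Variant place_spec e (w : overt H) : rvtx -> Type :=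
| PlaceSrc of w = osrc H : place_spec e w (inl (val e).1)
| PlaceTgt of w = otgt H : place_spec e w (inl (val e).2)
| PlaceInner (w' : inner) of w = val w' : place_spec e w (inr (e, w')).

Lemma placeP e w : place_spec e w (place e w).
Proof.
rewrite /place; case: insubP => [w' _ <-|]; first exact: PlaceInner.
rewrite negb_and !negbK; case: (eqVneq w (osrc H)) => [->|_ /= /eqP ->].
  by move=> _; exact: PlaceSrc.
exact: PlaceTgt.
Qed.

Lemma place_inj e : injective (place e).
Proof.
have ne := oarc_neq (valP e).
move=> w1 w2; case: placeP => [->|->|w1' ->]; case: placeP => [->|->|w2' ->] //.
- by case=> /eqP; rewrite (negbTE ne).
- by case=> /esym/eqP; rewrite (negbTE ne).
- by case=> ->.
Qed.

Lemma rarc_asym u v : rarc u v -> ~~ rarc v u.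
Proof.
case/rarcP=> e [w [w' [ww' <- <-]]]; apply/negP => /rarcP[f [z [z' [zz']]]].
have [<-|nef] := eqVneq e f.
  move=> /place_inj zw' /place_inj z'w; move: zz'; rewrite zw' z'w.
  by apply/negP/oarc_asym.
have ef1 : val e != val f by [].
move: ww' zz'; case: placeP => [->|->|z1 ->]; case: placeP => [->|->|w1 ->] //;
  case: placeP => [->|->|z2 ->]; case: placeP => [->|->|w2 ->] //;
  do ?[by move=> a1 a2; move: (oarc_neq a1); rewrite eqxx
      |by move=> a1 a2; move: (oarc_neq a2); rewrite eqxx
      |by move=> a1 a2; move/negP: (oarc_asym a1)].
all: try by move=> _ _ [] q; move: nef; rewrite q eqxx.
all: move=> a1 a2 [q1] [q2]; have := valP e; have := valP f; rewrite /= q1 q2.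
all: try by move=> b1 b2; move/negP: (oarc_asym b1).
all: move=> _ _; move: ef1.
all: by rewrite (surjective_pairing (val e)) (surjective_pairing (val f))
        q1 q2 eqxx.
Qed.

Lemma rarc_connected u v :
  connect [rel x y | rarc x y || rarc y x] u v.
Proof.
set adj := [rel x y | _].
have adjC : connect_sym adj.
  by apply: sym_connect_sym => x y; rewrite /adj /= orbC.
have hom e w w' : connect adj (place e w) (place e w').
  have /connectP[p pp ->] := oarc_connected w w'.
  elim: p w pp => [|z p IH] w /=; first by rewrite connect0.
  move=> /andP[wz /IH]; apply: connect_trans; apply: connect1.
  rewrite /adj /=; case/orP: wz => wz; apply/orP; [left|right].
    by apply/rarcP; exists e, w, z.
  by apply/rarcP; exists e, z, w.
have conl (x y : overt G) : connect adj (inl x) (inl y).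
  have /connectP[p pp ->] := oarc_connected x y.
  elim: p x pp => [|z p IH] x /=; first by rewrite connect0.
  move=> /andP[xz /IH]; apply: connect_trans; case/orP: xz => xz.
    pose e : oedge G := exist _ (x, z) xz.
    by have := hom e (osrc H) (otgt H); rewrite place_src place_tgt.
  pose e : oedge G := exist _ (z, x) xz.
  by have := hom e (otgt H) (osrc H); rewrite place_src place_tgt.
have toinl t : exists x, connect adj t (inl x).
  case: t => [x|[e w]]; first by exists x; rewrite connect0.
  exists (val e).1; have := hom e (val w) (osrc H).
  by rewrite place_src /place valK.
have [x ux] := toinl u; have [y vy] := toinl v.
apply: connect_trans ux _; apply: connect_trans (conl x y) _.
by rewrite adjC.
Qed.

Lemma rsrc_neq : (inl (osrc G) : rvtx) != inl (otgt G).
Proof. by apply/eqP => -[/eqP]; rewrite (negbTE (osrc_neq_otgt G)). Qed.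

Definition replace : ograph := OGraph rsrc_neq rarc_asym rarc_connected.

End Replace.

Section SingleArc.

Definition arc0 : rel bool := fun x y => ~~ x && y.

Lemma arc0_asym x y : arc0 x y -> ~~ arc0 y x.
Proof. by case: x; case: y. Qed.

Lemma arc0_connected x y : connect [rel u v | arc0 u v || arc0 v u] x y.
Proof.
by case: x; case: y; rewrite ?connect0//; apply: connect1.
Qed.

Definition single_arc : ograph :=
  @OGraph bool arc0 false true isT arc0_asym arc0_connected.

End SingleArc.

Fixpoint hier (G1 : ograph) (k : nat) : ograph :=
  if k is k'.+1 then replace (hier G1 k') G1 else single_arc.

Section Crossing.
Variables (R : realType) (G : ograph).

Definition open_adj (w : {ffun oedge G -> bool}) : rel (overt G) :=
  fun x y => [exists e : oedge G, w e && ((val e == (x, y)) || (val e == (y, x)))].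

Definition crossing (w : {ffun oedge G -> bool}) : bool :=
  connect (open_adj w) (osrc G) (otgt G).

Definition crossing_prob (p : R) : R :=
  \sum_(w : {ffun oedge G -> bool} | crossing w)
    \prod_(e : oedge G) (if w e then p else 1 - p).

Definition on_path (x : overt G) (p : seq (overt G)) (u v : overt G) : bool :=
  ((u, v) \in zip (x :: p) p) || ((v, u) \in zip (x :: p) p).

Definition is_path (x y : overt G) (p : seq (overt G)) : bool :=
  walk (@oadj G) x y p && uniq (x :: p).

Definition two_edge_disjoint_paths : Prop :=
  exists p q, [/\ is_path (osrc G) (otgt G) p, is_path (osrc G) (otgt G) q &
    forall u v, on_path (osrc G) p u v -> ~~ on_path (osrc G) q u v].

End Crossing.

(* Such graphs are countable, hence isomorphic to one with vertices in [nat].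
   The root edge is unoriented: isomorphisms may exchange its endpoints. *)
Record rgraph := RGraph {
  rvert : set nat;
  radj : rel nat;
  rroot : nat * nat;
  radj_sym : symmetric radj;
  radj_irr : irreflexive radj;
  radj_vert : forall x y, radj x y -> rvert x;
  rroot_adj : radj rroot.1 rroot.2;
  rconnected : forall x y, rvert x -> rvert y -> exists p, walk radj x y p;
  rlocfin : forall x, finite_set [set y | radj x y]
}.

Definition rball (g : rgraph) (r : nat) : set nat :=
  [set x | rvert g x /\ ((gdist (radj g) (rroot g).1 x <= r)%N \/
                         (gdist (radj g) (rroot g).2 x <= r)%N)].

(* Root-preserving isomorphism between the subgraphs of [g] and [h] induced by
   [A] and [B]. *)
Definition riso_on (g h : rgraph) (A B : set nat) : Prop :=
  exists f : nat -> nat,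
    [/\ set_bij A B f,
        forall x y, A x -> A y -> radj h (f x) (f y) = radj g x y &
        (f (rroot g).1, f (rroot g).2) = rroot h \/
        (f (rroot g).2, f (rroot g).1) = rroot h].

Definition riso (g h : rgraph) : bool := `[< riso_on g h (rvert g) (rvert h) >].

Definition riso_ball (r : nat) (g h : rgraph) : Prop :=
  riso_on g h (rball g r) (rball h r).

HB.instance Definition _ := gen_eqMixin rgraph.
HB.instance Definition _ := gen_choiceMixin rgraph.

Section RootedIsomorphism.

Lemma rroot_vert (g : rgraph) :
  rvert g (rroot g).1 /\ rvert g (rroot g).2.
Proof.
split; first exact: radj_vert (rroot_adj g).
by apply: (@radj_vert g _ (rroot g).1); rewrite radj_sym rroot_adj.
Qed.

Lemma rball_vert (g : rgraph) r : rball g r `<=` rvert g.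
Proof. by move=> x []. Qed.

Lemma rball_root (g : rgraph) r : rball g r (rroot g).1 /\ rball g r (rroot g).2.
Proof.
have [r1 r2] := rroot_vert g.
by split; split => //; [left|right]; (apply: leq_trans (@gdist_le _ _ _ _ [::] _) _;
  rewrite /walk /= ?eqxx).
Qed.

Lemma rball_walk (g : rgraph) r (s x : nat) p :
  s = (rroot g).1 \/ s = (rroot g).2 ->
  walk (radj g) s x p -> (size p <= r)%N -> rball g r x.
Proof.
move=> sr wp pr; split.
  have vs : rvert g s by have [? ?] := rroot_vert g; case: sr => ->.
  case/andP: wp => pp /eqP <-; elim: p {pr} s vs {sr} pp => //= z p IH s vs.
  move=> /andP[sz pp]; apply: IH => //.
  by apply: (@radj_vert g _ s); rewrite radj_sym.
by case: sr wp => -> wp; [left|right]; apply: leq_trans (gdist_le wp) pr.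
Qed.

Lemma rballP (g : rgraph) r x : rball g r x ->
  exists s p, [/\ s = (rroot g).1 \/ s = (rroot g).2,
    walk (radj g) s x p & (size p <= r)%N].
Proof.
have [v1 v2] := rroot_vert g.
case=> vx [] h.
  have [p wp] := rconnected v1 vx; have [q wq sq] := gdist_walk wp.
  by exists (rroot g).1, q; split; [left| |rewrite sq].
have [p wp] := rconnected v2 vx; have [q wq sq] := gdist_walk wp.
by exists (rroot g).2, q; split; [right| |rewrite sq].
Qed.

Lemma rball0 (g : rgraph) x :
  rball g 0 x -> x = (rroot g).1 \/ x = (rroot g).2.
Proof.
move=> /rballP[s [[|z p] [sr /andP[_ /eqP/= <-] //]]].
Qed.

Lemma rballS (g : rgraph) r x : rball g r.+1 x ->
  rball g r x \/ exists2 y, rball g r y & radj g y x.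
Proof.
move=> /rballP[s [p [sr wp]]]; case/lastP: p wp => [|p z] wp sp.
  by left; exact: rball_walk sr wp _.
right; move: wp; rewrite /walk rcons_path last_rcons => /andP[/andP[pp lz] /eqP <-].
exists (last s p) => //; apply: (@rball_walk g r s _ p) => //.
  by rewrite /walk pp eqxx.
by move: sp; rewrite size_rcons.
Qed.

Lemma rball_adj (g : rgraph) r x y : rball g r x -> radj g x y -> rball g r.+1 y.
Proof.
move=> /rballP[s [p [sr /andP[pp /eqP lx] sp]]] xy.
apply: (@rball_walk g _ s _ (rcons p y)) => //.
  by rewrite /walk rcons_path last_rcons pp lx xy eqxx.
by rewrite size_rcons.
Qed.

Lemma rball_le (g : rgraph) r r' : (r <= r')%N -> rball g r `<=` rball g r'.
Proof.
by move=> rr x [vx [h|h]]; split => //; [left|right]; exact: leq_trans h rr.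
Qed.

Lemma rball_cover (g : rgraph) x : rvert g x -> exists r, rball g r x.
Proof. by move=> vx; exists (gdist (radj g) (rroot g).1 x); split => //; left. Qed.

Lemma rball_finite (g : rgraph) r : finite_set (rball g r).
Proof.
elim: r => [|r IH].
  apply: (sub_finite_set (B := [set (rroot g).1; (rroot g).2])).
    by move=> x /rball0[]->; [left|right].
  by rewrite finite_setU; split; exact: finite_set1.
apply: (sub_finite_set (B := rball g r `|`
    \bigcup_(y in rball g r) [set x | radj g y x])).
  by move=> x /rballS[|[y yr yx]]; [left|right; exists y].
rewrite finite_setU; split => //; apply: bigcup_finite => // y _.
exact: rlocfin.
Qed.

Lemma set_bij_inv (A B : set nat) (f : nat -> nat) : set_bij A B f ->
  exists f', [/\ set_bij B A f', forall x, A x -> f' (f x) = x &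
    forall y, B y -> f (f' y) = y].
Proof.
move=> [fAB finj fsurj].
pose f' y := xget 0%N [set x | A x /\ f x = y].
have f'P y : B y -> A (f' y) /\ f (f' y) = y.
  by move=> /fsurj[x Ax fx]; rewrite /f'; case: xgetP => [z _|/(_ x)[]].
have f'K x : A x -> f' (f x) = x.
  by move=> Ax; have [Afx ffx] := f'P _ (fAB _ Ax); apply: finj; rewrite ?inE.
exists f'; split => //; last by move=> y /f'P[].
split.
- by move=> y /f'P[].
- move=> x y; rewrite !inE => Bx By fxy.
  by have [_ <-] := f'P x Bx; have [_ <-] := f'P y By; rewrite fxy.
- by move=> x Ax; exists (f x); [exact: fAB|rewrite f'K].
Qed.

Lemma riso_on_inv g h A B f : A (rroot g).1 -> A (rroot g).2 ->
  set_bij A B f ->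
  (forall x y, A x -> A y -> radj h (f x) (f y) = radj g x y) ->
  (f (rroot g).1, f (rroot g).2) = rroot h \/
  (f (rroot g).2, f (rroot g).1) = rroot h ->
  exists f', [/\ set_bij B A f',
    forall x y, B x -> B y -> radj g (f' x) (f' y) = radj h x y,
    (f' (rroot h).1, f' (rroot h).2) = rroot g \/
    (f' (rroot h).2, f' (rroot h).1) = rroot g &
    (forall x, A x -> f' (f x) = x) /\ (forall y, B y -> f (f' y) = y)].
Proof.
move=> A1 A2 fb fadj froot; have [f' [f'b f'K fK]] := set_bij_inv fb.
exists f'; split => //.
- move=> x y Bx By; have [f'BA _ _] := f'b.
  by rewrite -fadj ?fK //; exact: f'BA.
- by case: froot => <- /=; rewrite !f'K // -surjective_pairing; [left|right].
Qed.

Lemma riso_on_sym g h A B : A (rroot g).1 -> A (rroot g).2 ->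
  riso_on g h A B -> riso_on h g B A.
Proof.
move=> A1 A2 [f [fb fadj froot]].
by have [f' [? ? ? _]] := riso_on_inv A1 A2 fb fadj froot; exists f'.
Qed.

Lemma riso_on_trans g h k A B C : riso_on g h A B -> riso_on h k B C ->
  riso_on g k A C.
Proof.
move=> [f [fb fadj froot]] [f' [fb' fadj' froot']].
have [fAB _ _] := fb.
exists (f' \o f); split; first exact: set_bij_comp fb fb'.
  by move=> x y Ax Ay /=; rewrite fadj' ?fadj //; exact: fAB.
have [fr|fr] := froot; have [fr'|fr'] := froot'; rewrite -fr /= in fr';
  by [left|right].
Qed.

Lemma riso_refl : reflexive riso.
Proof.
move=> g; apply/asboolP; exists id; split => //.
  by split => // x Vx; exists x.
by left; rewrite -surjective_pairing.
Qed.

Lemma riso_sym : symmetric riso.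
Proof.
move=> g h; apply/asboolP/asboolP; apply: riso_on_sym;
  by have [] := rroot_vert g; have [] := rroot_vert h.
Qed.

Lemma riso_trans : transitive riso.
Proof.
by move=> h g k /asboolP gh /asboolP hk; apply/asboolP; exact: riso_on_trans hk.
Qed.

Lemma riso_ball_sym r g h : riso_ball r g h -> riso_ball r h g.
Proof. by have [? ?] := rball_root g r; exact: riso_on_sym. Qed.

Lemma riso_ball_trans r g h k :
  riso_ball r g h -> riso_ball r h k -> riso_ball r g k.
Proof. exact: riso_on_trans. Qed.

Lemma riso_ball0 g h : riso_ball 0 g h.
Proof.
pose f x := if x == (rroot g).1 then (rroot h).1 else (rroot h).2.
have neq k : ((rroot k).2 == (rroot k).1) = false.
  apply/eqP => e; have := rroot_adj k.
  by rewrite e radj_irr.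
have [g1 g2] := rball_root g 0; have [h1 h2] := rball_root h 0.
have f1 : f (rroot g).1 = (rroot h).1 by rewrite /f eqxx.
have f2 : f (rroot g).2 = (rroot h).2 by rewrite /f neq.
exists f; split.
- split.
  + by move=> x /rball0[]->; rewrite ?f1 ?f2.
  + move=> x y; rewrite !inE => /rball0[]-> /rball0[]->; rewrite ?f1 ?f2 // => /eqP.
      by rewrite eq_sym neq.
    by rewrite neq.
  + by move=> y /rball0[]->; [exists (rroot g).1|exists (rroot g).2].
- move=> x y /rball0[]-> /rball0[]->; rewrite ?f1 ?f2 ?radj_irr ?rroot_adj //.
  by rewrite (radj_sym g) (radj_sym h) !rroot_adj.
- by left; rewrite f1 f2 -surjective_pairing.
Qed.

(* An isomorphism between balls maps smaller balls to smaller balls. *)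
Lemma riso_ball_homo r r' g h f : (r' <= r)%N ->
  set_fun (rball g r) (rball h r) f ->
  (forall x y, rball g r x -> rball g r y -> radj h (f x) (f y) = radj g x y) ->
  (f (rroot g).1, f (rroot g).2) = rroot h \/
  (f (rroot g).2, f (rroot g).1) = rroot h ->
  set_fun (rball g r') (rball h r') f.
Proof.
move=> + fAB fadj froot; elim: r' => [|r' IH] rr x.
  have [h1 h2] := rball_root h 0.
  by move=> /rball0[]->; case: froot h1 h2 => <-.
move=> xr'; case: (rballS xr') => [xr|[y yr yx]].
  by apply: rball_le (leqnSn r') _ _; apply: IH => //; exact: ltnW.
apply: (@rball_adj h r' (f y)); first by apply: IH => //; exact: ltnW.
rewrite fadj //; first exact: rball_le (ltnW rr) _ yr.
exact: rball_le rr _ xr'.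
Qed.

Lemma riso_ball_le r r' g h : (r' <= r)%N -> riso_ball r g h -> riso_ball r' g h.
Proof.
move=> rr [f [fb fadj froot]]; have [fAB finj _] := fb.
have [g1 g2] := rball_root g r.
have [f' [[f'BA _ _] f'adj f'root [f'K fK]]] := riso_on_inv g1 g2 fb fadj froot.
exists f; split => //.
- split.
  + exact: riso_ball_homo rr fAB fadj froot.
  + by move=> x y; rewrite !inE => /(rball_le rr) xr /(rball_le rr) yr;
      apply: finj; rewrite inE.
  + move=> y yr'; exists (f' y); last by rewrite fK //; exact: rball_le yr'.
    exact: (riso_ball_homo rr f'BA f'adj f'root).
- by move=> x y /(rball_le rr) xr /(rball_le rr) yr; exact: fadj.
Qed.

End RootedIsomorphism.

Canonical riso_equiv := EquivRel riso riso_refl riso_sym riso_trans.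

Definition rdist (R : realType) (g h : rgraph) : R :=
  inf [set r.+1%:R^-1 | r in [set r | riso_ball r g h]].

Section RootedDistance.
Variable R : realType.
Implicit Types g h k : rgraph.

Let S g h : set R := [set r.+1%:R^-1 | r in [set r | riso_ball r g h]].

Let S_neq0 g h : S g h !=set0.
Proof. by exists 1; exists 0%N; [exact: riso_ball0|rewrite invr1]. Qed.

Let S_lb g h : lbound (S g h) 0.
Proof. by move=> _ [r _ <-]; rewrite invr_ge0. Qed.

Lemma rdist_ge0 g h : 0 <= rdist R g h.
Proof. exact: lb_le_inf (S_neq0 g h) (@S_lb g h). Qed.

Lemma rdist_le g h r : riso_ball r g h -> rdist R g h <= r.+1%:R^-1.
Proof. by move=> gh; apply: ge_inf; [exists 0; exact: S_lb|exists r]. Qed.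

Lemma rdist_lt g h e : rdist R g h < e ->
  exists2 r, riso_ball r g h & r.+1%:R^-1 < e.
Proof. by move=> /(inf_lt (S_neq0 g h))[_ [r gh <-] re]; exists r. Qed.

Lemma rdist_eq0P g h : rdist R g h = 0 <-> forall r, riso_ball r g h.
Proof.
split=> [gh0 r|ghr].
  have : rdist R g h < r.+1%:R^-1 by rewrite gh0 invr_gt0.
  move=> /rdist_lt[r' gh]; rewrite ltf_pV2 ?posrE // ltr_nat ltnS => rr.
  exact: riso_ball_le (ltnW rr) gh.
apply/eqP; rewrite eq_le rdist_ge0 andbT; apply/ler_addgt0Pr => e e0.
rewrite add0r; apply: le_trans (rdist_le (ghr (Num.truncn e^-1))) _.
by rewrite invf_ple ?posrE // ltW // Num.Theory.truncnS_gt // invr_ge0 ltW.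
Qed.

Lemma rdist_sym g h : rdist R g h = rdist R h g.
Proof.
rewrite /rdist; congr (inf (_ @` _)).
by apply/seteqP; split => r; exact: riso_ball_sym.
Qed.

Lemma rdist_triangle h g k : rdist R g k <= rdist R g h + rdist R h k.
Proof.
apply/ler_addgt0Pr => e e0.
have /rdist_lt[r1 gh r1e] : rdist R g h < rdist R g h + e by rewrite ltrDl.
have /rdist_lt[r2 hk r2e] : rdist R h k < rdist R h k + e by rewrite ltrDl.
have ghk : riso_ball (minn r1 r2) g k.
  by apply: riso_ball_trans (riso_ball_le (geq_minl _ _) gh)
    (riso_ball_le (geq_minr _ _) hk).
apply: le_trans (rdist_le ghk) _; rewrite /minn; case: ifP => _.
  by rewrite (le_trans (ltW r1e)) // lerD2r lerDl rdist_ge0.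
by rewrite (le_trans (ltW r2e)) // lerD2r lerDr rdist_ge0.
Qed.

(* Koenig's lemma, by a limit along an ultrafilter of isomorphisms of balls. *)
Lemma riso_of_balls g h : (forall r, riso_ball r g h) -> riso g h.
Proof.
move=> gh; apply/asboolP.
have [F [UF subF]] := ultraFilterLemma (@eventually_filter).
have PF : ProperFilter F := ultra_proper.
have large n : F [set r | (n <= r)%N].
  by apply: subF; exists n.
have Fex (P Q : set nat) : F P -> F Q -> exists r, P r /\ Q r.
  move=> FP FQ; have /filter_ex[r PQ] : F (P `&` Q) by exact: filterI. by exists r.
have lim (f : nat -> nat) (B : set nat) : finite_set B -> F [set r | B (f r)] ->
    exists y, B y /\ F [set r | f r = y].
  move=> /finite_seqP[s ->]; elim: s => [|a s IH].
    by move=> /filter_ex[r].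
  have [Fa|Fa] := in_ultra_setVsetC [set r | f r = a] UF.
    by move=> _; exists a; rewrite /= inE eqxx.
  move=> Fas; have /IH[y [ys Fy]] : F [set r | [set` s] (f r)].
    apply: filterS (filterI Fa Fas) => r [/= fa].
    by rewrite inE => /orP[/eqP|].
  by exists y; split => //; move: ys => /=; rewrite inE => ->; rewrite orbT.
pose phi r := sval (cid (gh r)).
have phiP r := svalP (cid (gh r)); rewrite -/(phi _) in phiP.
have [g1 g2] := rball_root g 0; have [h1 h2] := rball_root h 0.
have psiE r : exists f', [/\ set_bij (rball h r) (rball g r) f',
    forall x y, rball h r x -> rball h r y -> radj g (f' x) (f' y) = radj h x y,
    (f' (rroot h).1, f' (rroot h).2) = rroot g \/
    (f' (rroot h).2, f' (rroot h).1) = rroot g &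
    (forall x, rball g r x -> f' (phi r x) = x) /\
    (forall y, rball h r y -> phi r (f' y) = y)].
  have [pb padj proot] := phiP r; have [r1 r2] := rball_root g r.
  exact: riso_on_inv r1 r2 pb padj proot.
pose psi r := sval (cid (psiE r)).
have psiP r := svalP (cid (psiE r)); rewrite -/(psi _) in psiP.
have phi_sub m r : (m <= r)%N -> set_fun (rball g m) (rball h m) (phi r).
  by move=> mr; have [[pAB _ _] padj proot] := phiP r;
    exact: riso_ball_homo mr pAB padj proot.
have psi_sub m r : (m <= r)%N -> set_fun (rball h m) (rball g m) (psi r).
  by move=> mr; have [[pAB _ _] padj proot _] := psiP r;
    exact: riso_ball_homo mr pAB padj proot.
pose f x := xget 0%N [set y | F [set r | phi r x = y]].
have fP m x : rball g m x -> rball h m (f x) /\ F [set r | phi r x = f x].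
  move=> xm.
  have [|y [ym Fy]] := lim (fun r => phi r x) (rball h m) (rball_finite h m).
    by apply: filterS (large m) => r /= mr; exact: phi_sub.
  suff -> : f x = y by [].
  rewrite /f; case: xgetP => [z _ Fz|/(_ y)//].
  by have [r [/= <- ->]] := Fex _ _ Fz Fy.
have fP' x : rvert g x -> F [set r | phi r x = f x].
  by move=> /rball_cover[m /fP[]].
have ev x : rvert g x -> F [set r | rball g r x].
  by move=> /rball_cover[m xm]; apply: filterS (large m) => r mr; exact: rball_le xm.
have [v1 v2] := rroot_vert g.
exists f; split.
- split.
  + by move=> x /rball_cover[m /fP[+ _]]; exact: rball_vert.
  + move=> x y; rewrite !inE => vx vy fxy.
    have [r [[xr yr] /= [ex ey]]] := Fex _ _ (filterI (ev _ vx) (ev _ vy))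
      (filterI (fP' _ vx) (fP' _ vy)).
    have [[_ pinj _] _ _] := phiP r.
    have exy : phi r x = phi r y by rewrite ex ey.
    by apply: pinj exy; exact: mem_set.
  + move=> y /rball_cover[m ym].
    have [|x [xm Fx]] := lim (fun r => psi r y) (rball g m) (rball_finite g m).
      by apply: filterS (large m) => r /= mr; exact: psi_sub.
    exists x; first exact: rball_vert xm.
    have [_ Ff] := fP _ _ xm.
    have [r [[/= px fx] mr]] := Fex _ _ (filterI Fx Ff) (large m).
    have [_ _ _ [_ pK]] := psiP r.
    by rewrite -fx -px pK //; exact: rball_le ym.
- move=> x y vx vy.
  have [r [[xr yr] /= [<- <-]]] := Fex _ _ (filterI (ev _ vx) (ev _ vy))
      (filterI (fP' _ vx) (fP' _ vy)).
  by have [_ padj _] := phiP r; exact: padj.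
- have [r [/= <- <-]] := Fex _ _ (fP' _ v1) (fP' _ v2).
  by have [_ _] := phiP r.
Qed.

End RootedDistance.

(* The parameter [R] is only the type in which the metric takes its values. *)
Definition rspace (R : realType) : Type := {eq_quot riso}%qT.

Definition rclass (R : realType) (g : rgraph) : rspace R := (\pi_{eq_quot riso} g)%qT.

Definition rrepr (R : realType) (x : rspace R) : rgraph :=
  @repr _ {eq_quot riso}%qT x.

Section RootedSpace.
Variable R : realType.

HB.instance Definition _ := Choice.copy (rspace R) {eq_quot riso}%qT.

Lemma rclass_eqP (g h : rgraph) : rclass R g = rclass R h <-> riso g h.
Proof. by split=> [/eqmodP|gh]; [|apply/eqmodP]. Qed.

Lemma rreprK (x : rspace R) : rclass R (rrepr x) = x.
Proof. exact: reprK. Qed.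

Definition sdist (x y : rspace R) : R := rdist R (rrepr x) (rrepr y).

Lemma sdistxx x : sdist x x = 0.
Proof.
apply/rdist_eq0P => r; exists id; split => //; last first.
  by left; rewrite -surjective_pairing.
by split => // x0 Vx; exists x0.
Qed.

Lemma sdist_positivity x y : sdist x y = 0 -> x = y.
Proof.
by move=> /rdist_eq0P/riso_of_balls/rclass_eqP; rewrite !rreprK.
Qed.

Lemma sdist_sym x y : sdist x y = sdist y x.
Proof. exact: rdist_sym. Qed.

Lemma sdist_triangle y x z : sdist x z <= sdist x y + sdist y z.
Proof. exact: rdist_triangle. Qed.

HB.instance Definition _ := @isMetric.Build R (rspace R) sdist
  sdistxx sdist_positivity sdist_sym sdist_triangle.

End RootedSpace.

Section RootedFinite.
Variables (G : ograph) (e : oedge G).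

Let num (x : overt G) : nat := enum_rank x.

Let num_inj : injective num.
Proof. by move=> x y /ord_inj/enum_rank_inj. Qed.

Definition fin_adj : rel nat := fun m n =>
  [exists x : overt G, exists y : overt G,
     [&& oadj x y, m == enum_rank x :> nat & n == enum_rank y :> nat]].

Lemma fin_adjP m n :
  reflect (exists x y, [/\ oadj x y, m = num x & n = num y]) (fin_adj m n).
Proof.
apply: (iffP existsP) => [[x /existsP[y /and3P[xy /eqP-> /eqP->]]]|].
  by exists x, y.
by move=> [x [y [xy -> ->]]]; exists x; apply/existsP; exists y; rewrite xy !eqxx.
Qed.

Lemma fin_sym : symmetric fin_adj.
Proof.
by move=> m n; apply/fin_adjP/fin_adjP => -[x [y [xy mx ny]]]; exists y, x;
  rewrite oadj_sym.
Qed.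

Lemma fin_irr : irreflexive fin_adj.
Proof.
move=> m; apply/fin_adjP => -[x [y [xy -> /num_inj eq_xy]]].
by move: xy; rewrite -eq_xy /oadj /= orbb => /oarc_neq; rewrite eqxx.
Qed.

Lemma fin_vert m n : fin_adj m n -> [set k | (k < #|overt G|)%N] m.
Proof. by move=> /fin_adjP[x [y [_ -> _]]]; exact: ltn_ord. Qed.

Lemma fin_root : fin_adj (enum_rank (val e).1) (enum_rank (val e).2).
Proof.
apply/fin_adjP; exists (val e).1, (val e).2; split => //.
by apply/orP; left; exact: (valP e).
Qed.

Lemma fin_connected m n : (m < #|overt G|)%N -> (n < #|overt G|)%N ->
  exists p, walk fin_adj m n p.
Proof.
move=> mG nG; pose x := enum_val (Ordinal mG); pose y := enum_val (Ordinal nG).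
have -> : m = num x by rewrite /num /x enum_valK.
have -> : n = num y by rewrite /num /y enum_valK.
have /connectP[p pp ->] := oarc_connected x y.
exists (map num p); rewrite /walk last_map eqxx andbT.
elim: p x pp => //= z p IH x /andP[xz pp]; rewrite IH // andbT.
by apply/fin_adjP; exists x, z.
Qed.

Lemma fin_locfin m : finite_set [set n | fin_adj m n].
Proof.
apply: (sub_finite_set (B := `I_#|overt G|)); last exact: finite_II.
by move=> n /=; rewrite fin_sym => /fin_vert.
Qed.

(* Vertices are numbered by [enum_rank]; orientations are forgotten. *)
Definition rooted : rgraph := @RGraph [set k | (k < #|overt G|)%N] fin_adj
  (nat_of_ord (enum_rank (val e).1), nat_of_ord (enum_rank (val e).2))
  fin_sym fin_irr fin_vert fin_root fin_connected fin_locfin.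

End RootedFinite.

Definition single_arc_root : oedge single_arc := exist _ (false, true) isT.

HB.instance Definition _ (R : realType) :=
  isPointed.Build (rspace R) (rclass R (rooted single_arc_root)).

Section BernoulliProduct.
Variables (R : realType) (E : countType).

Definition config_generators : set (set (E -> bool)) :=
  [set A : set (E -> bool) | exists e, A = [set w : E -> bool | w e]].

Definition config := g_sigma_algebraType config_generators.

Definition bernoulli_product (p : R) (P : probability config R) : Prop :=
  forall (s : seq E) (b : E -> bool), uniq s ->
    P [set w : config | forall e, e \in s -> w e = b e] =
    (\prod_(e <- s) (if b e then p else 1 - p))%:E.

End BernoulliProduct.

Section UniformUnitInterval.
Variable R : realType.

Lemma unif01_itv : measurable (`[0, 1[%classic : set (measurableTypeR R)).
Proof. exact: measurable_itv. Qed.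

Definition unif01 : set (measurableTypeR R) -> \bar R :=
  mrestr (@lebesgue_measure R) unif01_itv.

HB.instance Definition _ :=
  Measure.copy unif01 (mrestr (@lebesgue_measure R) unif01_itv).

Let unif01_setT : unif01 setT = 1%E.
Proof.
by rewrite /unif01 /mrestr setTI lebesgue_measure_itv /= lte_fin ltr01 sube0.
Qed.

HB.instance Definition _ :=
  Measure_isProbability.Build _ _ _ unif01 unif01_setT.

End UniformUnitInterval.
Arguments unif01 : clear implicits.

(* Existence: the interval [0, 1[ is cut recursively in proportion p : 1 - p. *)
Section BernoulliExistence.
Variables (R : realType) (E : countType) (p : R).
Hypothesis p01 : 0 <= p <= 1.

Let p0 : 0 <= p. Proof. by case/andP: p01. Qed.
Let q0 : 0 <= 1 - p. Proof. by rewrite subr_ge0; case/andP: p01. Qed.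

Fixpoint bcell (b : nat -> R * R -> bool) (n : nat) : R * R :=
  if n is m.+1 then
    let s := bcell b m in
    if b m s then (s.1, p * s.2) else (s.1 + p * s.2, (1 - p) * s.2)
  else (0, 1).

Let bst (u : R) := bcell (fun _ s => u < s.1 + p * s.2).
Let bit (u : R) (n : nat) : bool := u < (bst u n).1 + p * (bst u n).2.
Let cell (b : nat -> bool) := bcell (fun i _ => b i).
Let wt (b : bool) : R := if b then p else 1 - p.

Let cell2 b n : (cell b n).2 = \prod_(i < n) wt (b i).
Proof.
elim: n => [|n IH]; first by rewrite big_ord0.
rewrite big_ord_recr /= -IH mulrC /cell /= -/(cell b n) /wt.
by case: (b n).
Qed.

Let wt_ge0 b : 0 <= wt b. Proof. by rewrite /wt; case: b; [exact: p0|exact: q0]. Qed.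

Let cell2_ge0 b n : 0 <= (cell b n).2.
Proof. by rewrite cell2; apply: prodr_ge0 => i _; exact: wt_ge0. Qed.

Let bst_cell b u n : (forall i, (i < n)%N -> bit u i = b i) ->
  bst u n = cell b n.
Proof.
elim: n => // n IH h; have e : bst u n = cell b n.
  by apply: IH => i /ltnW; exact: h.
have := h n (ltnSn n); rewrite /bit => hn.
by rewrite /bst /cell /= -/(bst u n) -/(cell b n) hn e.
Qed.

Let prefixE b n :
  [set u | 0 <= u < 1 /\ forall i, (i < n)%N -> bit u i = b i] =
  [set` `[(cell b n).1, (cell b n).1 + (cell b n).2[%R ].
Proof.
elim: n => [|n IH].
  apply/seteqP; split => u /=; rewrite in_itv /= add0r; first by case.
  by move=> ->.
have step u : (forall i, (i < n.+1)%N -> bit u i = b i) <->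
    (forall i, (i < n)%N -> bit u i = b i) /\ bit u n = b n.
  split=> [h|[h hn] i]; first by split => [i /ltnW|]; exact: h.
  by rewrite ltnS leq_eqVlt => /orP[/eqP ->|/h].
have w0 := cell2_ge0 b n.
have IHu u : (0 <= u < 1 /\ (forall i, (i < n)%N -> bit u i = b i)) <->
    (cell b n).1 <= u < (cell b n).1 + (cell b n).2.
  have /(congr1 (fun A => A u)) := IH; rewrite /= in_itv /= => ->.
  by split.
have ww : p * (cell b n).2 + (1 - p) * (cell b n).2 = (cell b n).2.
  by rewrite mulrBl mul1r addrCA subrr addr0.
have pw : 0 <= p * (cell b n).2 <= (cell b n).2.
  by rewrite mulr_ge0 //= ler_piMl //; case/andP: p01.
apply/seteqP; split => u /=; rewrite in_itv /=.
  move=> [u01 /step[h hn]]; have /IHu/andP[l1 l2] := conj u01 h.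
  move: hn; rewrite /bit (bst_cell h) /cell /= -/(cell b n).
  case: (b n) => /=; first by move=> ->; rewrite l1.
  move=> /negbT; rewrite -leNgt => -> /=.
  by rewrite -addrA ww.
move=> h; have lu : (cell b n).1 <= u < (cell b n).1 + (cell b n).2.
  move: h; rewrite /cell /= -/(cell b n); case: (b n) => /= /andP[h1 h2].
    by rewrite h1 /= (lt_le_trans h2) // lerD2l; case/andP: pw.
  have /andP[pw0 _] := pw; rewrite (le_trans _ h1) ?lerDl //=.
  by move: h2; rewrite -addrA ww.
have [u01 hu] := (IHu u).2 lu; split => //; apply/step; split => //.
rewrite /bit (bst_cell hu); move: h; rewrite /cell /= -/(cell b n).
case: (b n) => /= /andP[h1 h2]; first by rewrite h2.
by apply/negbTE; rewrite -leNgt.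
Qed.

Let measurable_bst n : measurable_fun setT (fun u => (bst u n).1) /\
  measurable_fun setT (fun u => (bst u n).2).
Proof.
elim: n => [|n [IH1 IH2]]; first by split; exact: measurable_cst.
have m2 : measurable_fun setT (fun u => p * (bst u n).2).
  by apply: measurable_funM => //; exact: measurable_cst.
have m1 : measurable_fun setT (fun u => (bst u n).1 + p * (bst u n).2).
  exact: measurable_funD.
have mb : measurable_fun setT (fun u : R => u < (bst u n).1 + p * (bst u n).2).
  by apply: measurable_fun_ltr => //; exact: measurable_id.
split.
- rewrite (_ : (fun u => _) = (fun u => if u < (bst u n).1 + p * (bst u n).2
    then (bst u n).1 else (bst u n).1 + p * (bst u n).2)).
    exact: measurable_fun_ifT.
  by apply/funext => u; rewrite /bst /= -/(bst u n); case: ifP.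
- rewrite (_ : (fun u => _) = (fun u => if u < (bst u n).1 + p * (bst u n).2
    then p * (bst u n).2 else (1 - p) * (bst u n).2)).
    apply: measurable_fun_ifT => //.
    by apply: measurable_funM => //; exact: measurable_cst.
  by apply/funext => u; rewrite /bst /= -/(bst u n); case: ifP.
Qed.

Let measurable_bit n b : measurable [set u | bit u n = b].
Proof.
have [m1 m2] := measurable_bst n.
have mb : measurable_fun setT (bit ^~ n).
  apply: measurable_fun_ltr; first exact: measurable_id.
  apply: measurable_funD => //.
  by apply: measurable_funM => //; exact: measurable_cst.
by have := mb measurableT [set b] I; rewrite setTI; exact.
Qed.

Let pattern (c : nat -> option bool) (n : nat) : set R :=
  [set u | forall i b, (i < n)%N -> c i = Some b -> bit u i = b].

Let owt (c : option bool) : R := if c is Some b then wt b else 1.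

Let measurable_pattern c n : measurable (pattern c n).
Proof.
rewrite (_ : pattern c n = \bigcap_(i in `I_n)
    if c i is Some b then [set u | bit u i = b] else setT).
  apply: bigcap_measurableType => i _.
  by case: (c i) => [b|]; [exact: measurable_bit|exact: measurableT].
apply/seteqP; split => u h.
  by move=> i /= ni; case: (c i) (h i) => [b|] // /(_ b ni erefl).
by move=> i b ni ci; have := h i ni; rewrite ci.
Qed.

Let unif01_pattern c n : unif01 R (pattern c n) = (\prod_(i < n) owt (c i))%:E.
Proof.
suff main k : forall c, (forall i, (k <= i < n)%N -> c i != None) ->
    unif01 R (pattern c n) = (\prod_(i < n) owt (c i))%:E.
  by apply: (main n) => i /andP[ni]; rewrite ltnNge ni.
elim: k {c} => [|k IH] c hc.
  pose b i := odflt true (c i).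
  have cb i : (i < n)%N -> c i = Some (b i).
    by move=> ni; rewrite /b; case: (c i) (hc i ni).
  rewrite (eq_bigr (fun i : 'I_n => wt (b i))); last first.
    by move=> i _; rewrite cb.
  rewrite -cell2 /unif01 /mrestr (_ : _ `&` _ =
     [set` `[(cell b n).1, (cell b n).1 + (cell b n).2[%R ]).
    rewrite lebesgue_measure_itv /= lte_fin ltrDl.
    case: ifPn => [_|]; first by rewrite -EFinB [_ + _ - _]addrC addKr.
    by rewrite -leNgt => w0; congr (_%:E); apply/eqP; rewrite eq_le cell2_ge0.
  rewrite -prefixE; apply/seteqP; split => u /=; rewrite in_itv /=.
    by move=> [h ->]; split => // i ni; apply: h => //; exact: cb.
  by move=> [-> h]; split => // i d ni; rewrite cb // => -[<-]; exact: h.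
have [kn|nk] := ltnP k n; last first.
  by apply: IH => i /andP[ki]; rewrite ltnNge (leq_trans nk ki).
case ck : (c k) => [d|]; last first.
  pose c' d i := if i == k then Some d else c i.
  have hc' d i : (k <= i < n)%N -> c' d i != None.
    rewrite /c'; case: (eqVneq i k) => // ik /andP[ki ni]; apply: hc.
    by rewrite ni andbT ltn_neqAle eq_sym ik.
  have split_c : pattern c n = pattern (c' true) n `|` pattern (c' false) n.
    apply/seteqP; split => u.
      move=> h; have hd : pattern (c' (bit u k)) n u.
        move=> i b ni; rewrite /c'; case: eqVneq => [-> [<-] //|_].
        exact: h.
      by move: hd; case: (bit u k) => ?; [left|right].
    have c'c d i b : c i = Some b -> c' d i = Some b.
      by rewrite /c'; case: eqVneq => // ->; rewrite ck.
    by case=> h i b ni ci; apply: h => //; exact: c'c.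
  have dis : pattern (c' true) n `&` pattern (c' false) n = set0.
    apply/seteqP; split => // u [h1 h2].
    have := h1 k true kn; have := h2 k false kn.
    by rewrite /c' eqxx => /(_ erefl) -> /(_ erefl).
  have addP : unif01 R (pattern c n) =
      (unif01 R (pattern (c' true) n) + unif01 R (pattern (c' false) n))%E.
    by rewrite split_c measureU //; exact: measurable_pattern.
  rewrite addP.
  rewrite !IH; [|exact: hc'..].
  rewrite -EFinD; congr (_%:E).
  have bD (a : nat -> option bool) : \prod_(i < n) owt (a i) =
      owt (a k) * \prod_(i < n | i != Ordinal kn) owt (a i).
    by rewrite (bigD1 (Ordinal kn)).
  rewrite !bD ck mul1r.
  have rest d : \prod_(i < n | i != Ordinal kn) owt (c' d i) =
      \prod_(i < n | i != Ordinal kn) owt (c i).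
    by apply: eq_bigr => i ik; rewrite /c' ifN.
  by rewrite !rest /c' eqxx -mulrDl addrC subrK mul1r.
apply: IH => i /andP[]; rewrite leq_eqVlt => /orP[/eqP <-|ki ni].
  by rewrite ck.
by apply: hc; rewrite ki.
Qed.

Let code (u : measurableTypeR R) : config E :=
  fun e => bit u (choice.pickle e).

Let measurable_code :
  @measurable_fun _ _ (measurableTypeR R) (config E) setT code.
Proof.
apply: (@measurability _ _ (measurableTypeR R) (config E) setT code
  (@config_generators E)) => //.
move=> _ [_ [e ->] <-]; rewrite setTI.
exact: (measurable_bit (choice.pickle e) true).
Qed.

Lemma bernoulli_product_exists :
  exists P : probability (config E) R, bernoulli_product p P.
Proof.
pose X : {mfun measurableTypeR R >-> config E} :=
  @mfun_Sub _ _ (measurableTypeR R) (config E) code (mem_set measurable_code).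
exists (distribution (unif01 R) X) => s b us.
pose c (t : seq E) i : option bool :=
  if @pickle_inv E i is Some e then (if e \in t then Some (b e) else None)
  else None.
have c_pickle t e : c t (choice.pickle e) = if e \in t then Some (b e) else None.
  by rewrite /c pickleK_inv.
pose n := \max_(e <- s) (choice.pickle e).+1.
have sn e : e \in s -> (choice.pickle e < n)%N.
  by move=> es; rewrite /n (big_rem e es) /= leq_max ltnSn.
transitivity (unif01 R (pattern (c s) n)).
  apply: (congr1 (unif01 R)).
  apply/seteqP; split => u h.
    move=> i d ni; rewrite /c; case ie : (@pickle_inv E i) => [e|] //.
    case: ifP => // es [<-]; have /= := h e es; rewrite /code.
    by have := @pickle_invK E i; rewrite ie /= => ->.
  move=> e es; apply: h; first exact: sn.
  by rewrite c_pickle es.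
rewrite unif01_pattern; congr (_%:E).
move: us sn; rewrite {}/n; move: (\max_(e <- s) _) => n.
elim: s => [|e s IH] /= => [_ _|/andP[es us] sn].
  rewrite big_nil big1 // => i _.
  by rewrite /c; case: (@pickle_inv E i).
have en : (choice.pickle e < n)%N by apply: sn; rewrite inE eqxx.
have {}IH := IH us (fun f fs => sn f (mem_behead (s := e :: s) fs)).
rewrite big_cons -IH (bigD1 (Ordinal en)) //=.
rewrite [in RHS](bigD1 (Ordinal en)) //= !c_pickle inE eqxx (negbTE es) /= mul1r.
congr (_ * _); apply: eq_bigr => i ie; congr owt; rewrite /c.
case ei : (@pickle_inv E i) => [f|] //; rewrite inE.
case: eqVneq => [fe|//]; move: ie; rewrite -val_eqE /= -fe.
by have := @pickle_invK E i; rewrite ei /= => ->; rewrite eqxx.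
Qed.

End BernoulliExistence.

Section Percolation.
Variable g : rgraph.

(* Each unoriented edge is listed once, smaller endpoint first. *)
Definition redge := {e : nat * nat | (e.1 < e.2)%N && radj g e.1 e.2}.

Definition open_radj (w : config redge) : rel nat := fun x y =>
  `[< exists e : redge, w e /\ (val e = (x, y) \/ val e = (y, x)) >].

Definition open_cluster (w : config redge) (x : nat) : set nat :=
  [set y | exists p, walk (open_radj w) x y p].

Definition root_to_infinity : set (config redge) :=
  [set w | infinite_set (open_cluster w (rroot g).1) \/
           infinite_set (open_cluster w (rroot g).2)].

End Percolation.

(* For [p] in [0, 1] this is the law of independent Bernoulli(p) edges, by
   [percolationP]. *)
Definition percolation (R : realType) (g : rgraph) (p : R) :
    probability (config (redge g)) R :=
  get [set P | bernoulli_product p P].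

Lemma percolationP (R : realType) (g : rgraph) (p : R) : 0 <= p <= 1 ->
  bernoulli_product p (percolation g p).
Proof.
move=> p01; have [P HP] := bernoulli_product_exists (redge g) p01.
exact: (@getI _ [set P | bernoulli_product p P] P HP).
Qed.

Definition theta (R : realType) (g : rgraph) (p : R) : \bar R :=
  percolation g p (@root_to_infinity g).

Definition critical_prob (R : realType) (g : rgraph) : R :=
  sup [set p | 0 <= p <= 1 /\ theta g p = 0%E].

Definition borel_rspace (R : realType) :=
  g_sigma_algebraType (@open (rspace R)).

(* Isomorphic graphs have the same critical probability, so the choice of the
   representative is irrelevant. *)
Definition pc (R : realType) (x : borel_rspace R) : R :=
  critical_prob R (rrepr (x : rspace R)).

(* The expectation of [f (G_k, E_k)], where [E_k] is a uniform edge of [G_k]. *)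
Definition hier_mean (R : realType) (G1 : ograph) (f : rspace R -> R) (k : nat) :
    R :=
  (\sum_(e : oedge (hier G1 k)) f (rclass R (rooted e))) /
    #|{: oedge (hier G1 k)}|%:R.

Definition is_BS_limit (R : realType) (G1 : ograph)
    (mu : probability (borel_rspace R) R) : Prop :=
  forall f : rspace R -> R, continuous f -> (exists M, forall x, `|f x| <= M) ->
    (hier_mean G1 f k)%:E @[k --> \oo] --> (\int[mu]_x (f x)%:E)%E.

(* Main.v *)
Require Import Defs.
From mathcomp Require Import all_boot all_order all_algebra.
From mathcomp Require Import all_classical all_reals all_analysis.
From mathcomp Require Import measurable_realfun.
From mathcomp Require Import lra zify.
Import Order.TTheory GRing.Theory Num.Theory.
Import numFieldNormedType.Exports.
Set Implicit Arguments.
Unset Strict Implicit.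
Unset Printing Implicit Defensive.
Local Open Scope classical_set_scope.
Local Open Scope ring_scope.

(** Let [f] be the crossing probability of [G_1]. Call an edge of [G_k] open when
   its copy of [G_1] in [G_(k+1)] is crossed. This turns percolation of parameter
   [p] on [G_(k+1)] into percolation of parameter [f p] on [G_k] ([Pr_replace]),
   and connections between old vertices are the same in both ([linked_coarse],
   [linked_locally]). So the large scale depends on the iterates of [f].

   The map [f] has one fixed point [pstar] in ]0, 1[, and it repels. The terminals
   of [G_1] are not adjacent, so a crossing needs two open edges and [f p] is
   [O(p ^ 2)]; two paths are edge-disjoint, so a non-crossing needs two closed
   edges and [1 - f p] is [O((1 - p) ^ 2)]. Hence the graph of [f] starts below
   the diagonal and ends above it. By the inequality of Moore and Shannon
   ([Pr_odds]) the odds of crossing grow at least as fast as the odds of an edge,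
   so the graph is below the diagonal before a fixed point and above it after.
   With two fixed points, [f] would be the identity between them, hence
   everywhere, since it is a polynomial; but [f p] is [O(p ^ 2)]. The iterates
   of [f] therefore tend to 0 below [pstar] and to 1 above it.

   Below [pstar], if the cluster of the root of [G_(k+n)] goes far, then in [G_n]
   the coarse root has an open edge at one of its endpoints
   ([escapes_replace]), where edges are open with the tiny probability
   [iter k f p]. The degree of the endpoints of a uniform edge is tight: when the
   edges are replaced, a half-edge of high degree has to sit over an old one, and
   each old one carries at most [m - 1] new ones, where [m] is the number of edges
   of [G_1]; so the proportion of such half-edges contracts ([high_replace]).
   Hence the mean probability of escaping is small ([escapes_upper_bound]).

   Above [pstar], ask at each level that the copy of [G_1] around the root be fully
   open. This joins the root to both terminals of [G_n], whose distance is at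
   least [2 ^ n], with a probability bounded below, because the defects
   [1 - iter k f p] decrease quadratically ([joins_lower_bound]). The bound is
   uniform in the root.

   Escaping from the ball of radius [r] depends on the ball of radius [r + 1] only
   ([theta_ball_iso]), so its probability is a locally constant function on the
   space of rooted graphs and the weak limit sees it. Below [pstar] the mean bound
   gives that [theta] vanishes almost surely, for countably many parameters.
   Above it, almost surely each ball of the limit occurs in some [G_n] with [n]
   large, so the uniform bound holds in the limit for all parameters at once. *)

Local Notation rgraph := Defs.rgraph.

(** * Expectations over finitely many independent bits *)

Section Expectation.
Variable R : realType.

Definition upd (E : eqType) (w : E -> bool) (e : E) (b : bool) : E -> bool :=
  fun e' => if e' == e then b else w e'.

Lemma updK (E : eqType) (w : E -> bool) e b c : upd (upd w e b) e c = upd w e c.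
Proof. by apply/funext => e'; rewrite /upd; case: (e' == e). Qed.

Lemma updC (E : eqType) (w : E -> bool) e e' b c : e != e' ->
  upd (upd w e b) e' c = upd (upd w e' c) e b.
Proof.
move=> ne; apply/funext => i; rewrite /upd.
by case: eqVneq => [->|//]; rewrite eq_sym (negbTE ne).
Qed.

Lemma upd_same (E : eqType) (w : E -> bool) e : upd w e (w e) = w.
Proof. by apply/funext => i; rewrite /upd; case: eqVneq => [->|]. Qed.

(** The mean of [F] when each bit [e] of [s] is true with probability [x e] and the
   other bits are false. The product measure is integrated bit by bit, so that
   proofs go by induction on [s], over any type of edges. *)
Fixpoint Ex (E : eqType) (x : E -> R) (s : seq E) (F : (E -> bool) -> R) : R :=
  if s is e :: s' then
    x e * Ex x s' (fun w => F (upd w e true)) +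
    (1 - x e) * Ex x s' (fun w => F (upd w e false))
  else F (fun=> false).

Definition Pr (E : eqType) (x : E -> R) (s : seq E) (A : (E -> bool) -> bool) : R :=
  Ex x s (fun w => (A w)%:R).

Section Basic.
Variables (E : eqType) (x : E -> R).
Implicit Types (F : (E -> bool) -> R) (A : (E -> bool) -> bool) (s : seq E).

Lemma eq_Ex s F F' : (forall w, F w = F' w) -> Ex x s F = Ex x s F'.
Proof. by move=> FF; congr Ex; apply/funext. Qed.

Lemma Ex_const s c : Ex x s (fun=> c) = c.
Proof. by elim: s => //= e s ->; lra. Qed.

Lemma ExD s F F' : Ex x s (fun w => F w + F' w) = Ex x s F + Ex x s F'.
Proof. by elim: s F F' => //= e s IH F F'; rewrite !IH; lra. Qed.

Lemma ExZ s c F : Ex x s (fun w => c * F w) = c * Ex x s F.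
Proof. by elim: s F => //= e s IH F; rewrite !IH; lra. Qed.

Lemma Ex_sum s (I : Type) (r : seq I) (F : I -> (E -> bool) -> R) :
  Ex x s (fun w => \sum_(i <- r) F i w) = \sum_(i <- r) Ex x s (F i).
Proof.
elim: r => [|i r IH].
  by rewrite big_nil -[RHS](Ex_const s); apply: eq_Ex => w; rewrite big_nil.
rewrite big_cons -IH -ExD; apply: eq_Ex => w; exact: big_cons.
Qed.

(** Any bit may be integrated first, because updates of distinct bits commute. *)
Lemma Ex_split s F e : e \in s -> Ex x s F =
  x e * Ex x s (fun w => F (upd w e true)) +
  (1 - x e) * Ex x s (fun w => F (upd w e false)).
Proof.
elim: s F => //= e' s IH F; rewrite inE; have [<- _|ne /= es] := eqVneq e e'.
  have K b c : Ex x s (fun w => F (upd (upd w e b) e c)) =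
      Ex x s (fun w => F (upd w e c)) by apply: eq_Ex => w; rewrite updK.
  by rewrite !K; lra.
rewrite (IH (fun w => F (upd w e' true))) // (IH (fun w => F (upd w e' false))) //.
have C b c : Ex x s (fun w => F (upd (upd w e b) e' c)) =
    Ex x s (fun w => F (upd (upd w e' c) e b)) by apply: eq_Ex => w; rewrite updC.
by rewrite !C; lra.
Qed.

Lemma Pr_and_true s A e : e \in s ->
  Pr x s (fun w => w e && A w) = x e * Pr x s (fun w => A (upd w e true)).
Proof.
move=> es; rewrite /Pr (Ex_split _ es) [X in _ + _ * X](_ : _ = 0).
  by rewrite mulr0 addr0; congr (_ * _); apply: eq_Ex => w; rewrite /upd eqxx.
by rewrite -[RHS](Ex_const s); apply: eq_Ex => w; rewrite /upd eqxx.
Qed.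

Lemma Pr_and_false s A e : e \in s ->
  Pr x s (fun w => ~~ w e && A w) = (1 - x e) * Pr x s (fun w => A (upd w e false)).
Proof.
move=> es; rewrite /Pr (Ex_split _ es) [X in _ * X + _](_ : _ = 0).
  by rewrite mulr0 add0r; congr (_ * _); apply: eq_Ex => w; rewrite /upd eqxx.
by rewrite -[RHS](Ex_const s); apply: eq_Ex => w; rewrite /upd eqxx.
Qed.

Hypothesis x01 : forall e, 0 <= x e <= 1.

Lemma Ex_le s F F' : (forall w, F w <= F' w) -> Ex x s F <= Ex x s F'.
Proof.
elim: s F F' => [|e s IH] F F' FF /=; first exact: FF.
have /andP[x0 x1] := x01 e.
by apply: lerD; apply: ler_wpM2l => //; rewrite ?subr_ge0 //; apply: IH => w; exact: FF.
Qed.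

Lemma Pr_le s A A' : (forall w, A w -> A' w) -> Pr x s A <= Pr x s A'.
Proof.
move=> AA; apply: Ex_le => w; rewrite ler_nat.
by have := AA w; case: (A w) => // ->.
Qed.

Lemma Pr_ge0 s A : 0 <= Pr x s A.
Proof. by rewrite -(Ex_const s 0); apply: Ex_le => w; exact: ler0n. Qed.

Lemma Pr_le1 s A : Pr x s A <= 1.
Proof. by rewrite -(Ex_const s 1); apply: Ex_le => w; rewrite lern1 leq_b1. Qed.

Lemma Pr_exists s (I : finType) (A : (E -> bool) -> bool) (B : I -> (E -> bool) -> bool) :
  (forall w, A w -> exists i, B i w) -> Pr x s A <= \sum_i Pr x s (B i).
Proof.
move=> AB; rewrite -Ex_sum; apply: Ex_le => w.
have [Aw|_] := boolP (A w); last by apply: sumr_ge0 => i _; exact: ler0n.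
have [i Bi] := AB _ Aw; rewrite (bigD1 i) //= Bi lerDl.
by apply: sumr_ge0 => j _; exact: ler0n.
Qed.

End Basic.

Lemma PrN (E : eqType) (x : E -> R) s A : Pr x s (fun w => ~~ A w) = 1 - Pr x s A.
Proof.
rewrite -(Ex_const x s 1) -mulN1r -ExZ -ExD; apply: eq_Ex => w.
by case: (A w); rewrite ?mulN1r ?subrr ?oppr0 ?addr0.
Qed.

(** The mean does not depend on how the bits are named; this compares percolation on
   graphs with different types of edges. *)
Lemma Ex_transport (E E' : eqType) (x : E -> R) (x' : E' -> R) (f : E -> E')
    (s : seq E) F F' :
  (forall e, e \in s -> x e = x' (f e)) -> uniq (map f s) ->
  (forall w w', {in s, forall e, w e = w' (f e)} -> F w = F' w') ->
  Ex x s F = Ex x' (map f s) F'.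
Proof.
elim: s F F' => [|e s IH] F F' xx /= => [_ FF|/andP[fe us] FF]; first exact: FF.
have us' b : Ex x s (fun w => F (upd w e b)) =
    Ex x' (map f s) (fun w => F' (upd w (f e) b)).
  apply: IH => // [e' es|w w' ww]; first by apply: xx; rewrite inE es orbT.
  apply: FF => e'; rewrite inE /upd; case: eqVneq => [-> _|ne /= es].
    by rewrite eqxx.
  case: eqVneq => [fe'|_]; last exact: ww.
  by move: fe; rewrite -fe' map_f.
by rewrite !us' xx ?inE ?eqxx.
Qed.

Definition depends (E : eqType) (T : Type) (s : seq E) (A : (E -> bool) -> T) : Prop :=
  forall w w', {in s, forall e, w e = w' e} -> A w = A w'.

Lemma depends_upd (E : eqType) (T : Type) e s (A : (E -> bool) -> T) b :
  depends (e :: s) A -> depends s (fun w => A (upd w e b)).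
Proof.
move=> dA w w' ww; apply: dA => e'; rewrite inE /upd.
by case: eqVneq => //= _; exact: ww.
Qed.

Section Renormalization.
Variables (E H : eqType).
Implicit Types (C : E -> (H -> bool) -> bool) (w : E * H -> bool).

Let blk (C : E -> (H -> bool) -> bool) (w : E * H -> bool) : E -> bool :=
  fun e => C e (fun g => w (e, g)).

(* Integrating the bits of one block leaves one bit for the block. In the induction
   the event [C e] of this block is restricted to the bits not yet integrated. *)
Let Ex_block (x : E * H -> R) (sH : seq H) (t : seq (E * H)) C F e :
  depends sH (C e) ->
  Ex x ([seq (e, g) | g <- sH] ++ t) (fun w => F (blk C w)) =
  Pr (fun g => x (e, g)) sH (C e) * Ex x t (fun w => F (upd (blk C w) e true)) +
  (1 - Pr (fun g => x (e, g)) sH (C e)) * Ex x t (fun w => F (upd (blk C w) e false)).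
Proof.
elim: sH C => [|g sH IH] C dC /=.
  have cE w : blk C w = upd (blk C w) e (C e (fun=> false)).
    rewrite -{1}(upd_same (blk C w) e); congr (upd _ _ _); exact: dC.
  rewrite (eq_Ex x t (F' := fun w => F (upd (blk C w) e (C e (fun=> false))))); last first.
    by move=> w; rewrite {1}cE.
  by rewrite /Pr /=; case: (C e _) => /=; rewrite ?mulr1n ?mulr0n; lra.
pose C' b e' h := if e' == e then C e (upd h g b) else C e' h.
have step b w : blk C (upd w (e, g) b) = blk (C' b) w.
  apply/funext => e'; rewrite /blk /C'; case: eqVneq => [->|ne].
    congr (C e _); apply/funext => g'; rewrite /upd xpair_eqE eqxx.
    by case: eqVneq.
  by congr (C e' _); apply/funext => g'; rewrite /upd xpair_eqE (negbTE ne).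
have updE b c w : upd (blk (C' b) w) e c = upd (blk C w) e c.
  by apply/funext => e'; rewrite /upd /blk /C'; case: eqVneq.
have main b : Ex x ([seq (e, g) | g <- sH] ++ t) (fun w => F (blk C (upd w (e, g) b))) =
  Pr (fun g => x (e, g)) sH (fun h => C e (upd h g b)) *
    Ex x t (fun w => F (upd (blk C w) e true)) +
  (1 - Pr (fun g => x (e, g)) sH (fun h => C e (upd h g b))) *
    Ex x t (fun w => F (upd (blk C w) e false)).
  rewrite (eq_Ex _ _ (F' := fun w => F (blk (C' b) w))); last by move=> w; rewrite step.
  have C'e : C' b e = fun h => C e (upd h g b) by rewrite /C' eqxx.
  rewrite IH; last by rewrite C'e; exact: depends_upd.
  rewrite C'e; congr (_ * _ + _ * _); apply: eq_Ex => w; by rewrite updE.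
rewrite !main /Pr /=; lra.
Qed.

(** Renormalization: if the bits are grouped in independent blocks, then a
   function of one bit per block, each computed inside its block, sees again
   independent bits. *)
Lemma Ex_renorm (x : E * H -> R) (sE : seq E) (sH : seq H) C F :
  (forall e, depends sH (C e)) -> depends sE F ->
  Ex x [seq (e, g) | e <- sE, g <- sH] (fun w => F (fun e => C e (fun g => w (e, g)))) =
  Ex (fun e => Pr (fun g => x (e, g)) sH (C e)) sE F.
Proof.
move=> dC; elim: sE F => [|e sE IH] F dF /=; first exact: dF.
rewrite (Ex_block _ _ F (dC e)).
by rewrite (IH (fun v => F (upd v e true))) ?(IH (fun v => F (upd v e false))) //;
  exact: depends_upd.
Qed.

End Renormalization.
End Expectation.

Section MooreShannon.
Variable R : realType.

Definition increasing_event (E : Type) (A : (E -> bool) -> bool) : Prop :=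
  forall w w' : E -> bool, (forall e, w e -> w' e) -> A w -> A w'.

(* The difference of the two sides of the goal, times [Da * Db], as a sum of
   nonnegative terms. *)
Let odds_identity (p q a b a' b' Da Db : R) :
  Da * Db * ((q * a' + (1 - q) * b') * (p * Da + (1 - p) * Db) -
    q * (1 - p) * (p * a + (1 - p) * b)) =
  (q * ((a' * Da - q * (1 - p) * a) * Db) + (1 - q) * ((b' * Db - q * (1 - p) * b) * Da)) *
  (p * Da + (1 - p) * Db) +
  q * (1 - p) * ((q * (1 - p) * Db - p * (1 - q) * Da) * (a * Db - b * Da)).
Proof. lra. Qed.

(** The inductive step of Moore and Shannon's inequality, for an increasing event
   whose probability is [a] or [b], at [p], according to one bit, and [a'] or [b'] at
   [q]. In the notation of the proof, the hypotheses bound [a'] and [b'] below by [t * a / Da] and [t * b / Db], and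
   the conclusion is increasing in [a'] and [b'], so these extremal values
   decide. *)
Lemma odds_step (p q a b a' b' : R) :
  0 < p -> p <= q -> q < 1 -> 0 <= b -> b <= a -> a <= 1 ->
  q * (1 - p) * (a * (1 - a')) <= p * (1 - q) * (a' * (1 - a)) ->
  q * (1 - p) * (b * (1 - b')) <= p * (1 - q) * (b' * (1 - b)) ->
  q * (1 - p) * ((p * a + (1 - p) * b) * (1 - (q * a' + (1 - q) * b'))) <=
  p * (1 - q) * ((q * a' + (1 - q) * b') * (1 - (p * a + (1 - p) * b))).
Proof.
move=> p0 pq q1 b0 ba a1 Ha Hb.
have q0 : 0 < q by lra.
have s0 : 0 < p * (1 - q) by rewrite mulr_gt0 // subr_gt0.
have st : p * (1 - q) <= q * (1 - p) by lra.
set s := p * (1 - q) in Ha Hb s0 st *; set t := q * (1 - p) in Ha Hb st *.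
have t0 : 0 < t by lra.
pose Da := s * (1 - a) + t * a; pose Db := s * (1 - b) + t * b.
have D_gt0 c : 0 <= c -> c <= 1 -> 0 < s * (1 - c) + t * c.
  move=> c0 c1; have [->|cN0] := eqVneq c 0; first by rewrite subr0 mulr1 mulr0 addr0.
  have c_gt0 : 0 < c by rewrite lt_def cN0.
  by rewrite ltr_wpDl ?(mulr_gt0 t0) // mulr_ge0 ?subr_ge0 // ltW.
have Da0 : 0 < Da by apply: D_gt0 => //; lra.
have Db0 : 0 < Db by apply: D_gt0 => //; lra.
have DF0 : 0 < p * Da + (1 - p) * Db by rewrite addr_gt0 // mulr_gt0 // subr_gt0; lra.
have u0 : 0 <= a' * Da - t * a by rewrite /Da; lra.
have v0 : 0 <= b' * Db - t * b by rewrite /Db; lra.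
have k0 : 0 <= t * Db - s * Da.
  have -> : t * Db - s * Da = s * (t - s) * (1 - a) + t * (t - s) * b by rewrite /Da /Db; lra.
  by rewrite addr_ge0 // mulr_ge0 // ?subr_ge0 // mulr_ge0 ?subr_ge0 // ltW.
rewrite -subr_ge0 -(pmulr_rge0 _ (mulr_gt0 Da0 Db0)).
have -> : Da * Db * (s * ((q * a' + (1 - q) * b') * (1 - (p * a + (1 - p) * b))) -
    t * ((p * a + (1 - p) * b) * (1 - (q * a' + (1 - q) * b')))) =
  (q * ((a' * Da - t * a) * Db) + (1 - q) * ((b' * Db - t * b) * Da)) *
    (p * Da + (1 - p) * Db) + t * ((t * Db - s * Da) * (s * (a - b))).
  have -> : s * (a - b) = a * Db - b * Da by rewrite /Da /Db; lra.
  rewrite -odds_identity -/s -/t.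
  have -> : p * Da + (1 - p) * Db =
    s * (1 - (p * a + (1 - p) * b)) + t * (p * a + (1 - p) * b) by rewrite /Da /Db; lra.
  clearbody s t Da Db; lra.
rewrite addr_ge0 // mulr_ge0 ?(ltW DF0) ?(ltW t0) //.
  apply: addr_ge0; (apply: mulr_ge0; [lra|]); apply: mulr_ge0 => //; exact: ltW.
apply: mulr_ge0 => //; apply: mulr_ge0; [exact: ltW|lra].
Qed.

(** Moore and Shannon's inequality, in the integrated form that needs no derivative:
   the odds of an increasing event grow at least as fast as those of one bit.
   Multiplying out the odds makes it meaningful for trivial events, which occur
   in the induction. *)
Lemma Pr_odds (E : eqType) (p q : R) (s : seq E) (A : (E -> bool) -> bool) :
  increasing_event A -> 0 < p -> p <= q -> q < 1 ->
  q * (1 - p) * (Pr (fun=> p) s A * (1 - Pr (fun=> q) s A)) <=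
  p * (1 - q) * (Pr (fun=> q) s A * (1 - Pr (fun=> p) s A)).
Proof.
move=> + p0 pq q1; elim: s A => [|e s IH] A mA; rewrite /Pr /=.
  by case: (A _); rewrite ?subrr ?mul0r ?mulr0 ?mul0r.
have p01 : forall e : E, 0 <= (fun=> p) e <= 1 by move=> _; apply/andP; split; lra.
have mA' b : increasing_event (fun w => A (upd w e b)).
  move=> w w' ww; apply: mA => i; rewrite /upd; case: eqVneq => // _; exact: ww.
apply: odds_step => //; [exact: Pr_ge0| |exact: Pr_le1|exact: (IH _ (mA' true))|exact: (IH _ (mA' false))].
by apply: (Pr_le p01) => w; apply: mA => i; rewrite /upd; case: eqVneq.
Qed.

Lemma Ex_poly (E : eqType) (s : seq E) (F : (E -> bool) -> R) :
  exists P : {poly R}, forall p, Ex (fun=> p) s F = P.[p].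
Proof.
elim: s F => [|e s IH] F /=.
  by exists (F (fun=> false))%:P => p; rewrite hornerC.
have [P1 H1] := IH (fun w => F (upd w e true)).
have [P2 H2] := IH (fun w => F (upd w e false)).
by exists ('X * P1 + (1 - 'X) * P2) => p; rewrite H1 H2 !hornerE.
Qed.

End MooreShannon.

Section FiniteProduct.
Variables (R : realType) (E : finType) (x : E -> R).

Let wt (w : {ffun E -> bool}) e : R := if w e then x e else 1 - x e.
Let M (F : (E -> bool) -> R) : R := \sum_(w : {ffun E -> bool}) (\prod_e wt w e) * F w.

Let M_split F e : M F = x e * M (fun w => F (upd w e true)) +
   (1 - x e) * M (fun w => F (upd w e false)).
Proof.
pose mu w : R := \prod_(e' | e' != e) wt w e'.
pose S b : R := \sum_(w : {ffun E -> bool} | w e == b) mu w * F w.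
pose flip (w : {ffun E -> bool}) : {ffun E -> bool} := finfun (upd w e (~~ w e)).
have flipK : involutive flip.
  move=> w; apply/ffunP => e'; rewrite !ffunE /upd.
  case: eqVneq => [->|ne]; first by rewrite eqxx negbK.
  by rewrite ffunE /upd (negbTE ne).
have muE w : \prod_e wt w e = wt w e * mu w by rewrite (bigD1 e).
have mu_flip w : mu (flip w) = mu w.
  by apply: eq_bigr => e' ne; rewrite /wt !ffunE /upd (negbTE ne).
have ME G : M G = x e * (\sum_(w : {ffun E -> bool} | w e == true) mu w * G w) +
    (1 - x e) * (\sum_(w : {ffun E -> bool} | w e == false) mu w * G w).
  rewrite /M (bigID (fun w : {ffun E -> bool} => w e == true)) /= !mulr_sumr; congr (_ + _).
    by apply: eq_bigr => w /eqP we; rewrite muE {1}/wt we mulrA.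
  rewrite (eq_bigl (fun w : {ffun E -> bool} => w e == false)); last first.
    by move=> w; case: (w e).
  by apply: eq_bigr => w /eqP we; rewrite muE {1}/wt we mulrA.
have updS b : M (fun w => F (upd w e b)) = S b.
  rewrite ME.
  have same : \sum_(w : {ffun E -> bool} | w e == b) mu w * F (upd w e b) = S b.
    by apply: eq_bigr => w /eqP <-; rewrite upd_same.
  have other : \sum_(w : {ffun E -> bool} | w e == ~~ b) mu w * F (upd w e b) = S b.
    rewrite (reindex_inj (inv_inj flipK)) /S; apply: eq_big => [w|w /eqP].
      by clear same; rewrite ffunE /upd eqxx; case: (w e); case: b.
    rewrite ffunE /upd eqxx => /negb_inj we; rewrite mu_flip; congr (_ * F _).
    by apply/funext => e'; rewrite ffunE /upd; case: eqVneq => [->|].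
  by move: same other; case: b => /= -> ->; lra.
by rewrite !updS ME.
Qed.

(** Averaging a function over one bit does not change its weighted sum; once all the bits of
   [s] are averaged, the function is constant. *)
Lemma Ex_ffun (s : seq E) F : depends s F ->
  Ex x s F = \sum_(w : {ffun E -> bool}) (\prod_e wt w e) * F w.
Proof.
move=> dF; symmetry; rewrite -/(M F); elim: s F dF => [|e s IH] F dF.
  have Fc w : F w = F (fun=> false) by exact: dF.
  rewrite /M /=; under eq_bigr => w _ do rewrite Fc.
  rewrite -mulr_suml -(@bigA_distr_bigA _ _ _ _ _ _ _ (fun e b => if b then x e else 1 - x e)).
  by rewrite big1 ?mul1r // => e _; rewrite big_bool /=; lra.
by rewrite (M_split F e) /= !IH //; exact: depends_upd.
Qed.

Lemma depends_enum (T : Type) (A : (E -> bool) -> T) : depends (enum E) A.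
Proof. by move=> w w' ww; congr A; apply/funext => e; rewrite ww // mem_enum. Qed.

Lemma Ex_enum (s : seq E) F : depends s F -> Ex x s F = Ex x (enum E) F.
Proof. by move=> dF; rewrite !Ex_ffun //; exact: depends_enum. Qed.

End FiniteProduct.

(** * Cylinder events of the infinite product measure *)

Section BernoulliCylinders.
Variables (R : realType) (E : countType).
Implicit Types (A : (E -> bool) -> bool) (s t : seq E).

Lemma measurable_bit (e : E) b : measurable [set w : config E | w e = b].
Proof.
have mt : measurable [set w : config E | w e].
  by apply: sub_sigma_algebra; exists e.
case: b; first exact: mt.
rewrite (_ : [set w | _] = ~` [set w : config E | w e]); first exact: measurableC.
by apply/seteqP; split => w /=; case: (w e).
Qed.

Lemma measurable_cylinder t (b : E -> bool) :
  measurable [set w : config E | forall e, e \in t -> w e = b e].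
Proof.
elim: t => [|e t IH].
  by rewrite (_ : [set w | _] = setT)//; apply/seteqP; split.
rewrite (_ : [set w | _] = [set w : config E | w e = b e] `&`
    [set w : config E | forall e, e \in t -> w e = b e]).
  by apply: measurableI => //; exact: measurable_bit.
apply/seteqP; split => w /=.
  by move=> h; split; [apply: h; rewrite inE eqxx|move=> i it; apply: h; rewrite inE it orbT].
by move=> [we wt] i; rewrite inE => /orP[/eqP ->//|]; exact: wt.
Qed.

Lemma measurable_depends s A : depends s A -> measurable [set w : config E | A w].
Proof.
elim: s A => [|e s IH] A dA.
  have Ac w : A w = A (fun=> false) by exact: dA.
  case A0 : (A (fun=> false)).
    rewrite (_ : [set w | _] = setT) //; apply/seteqP; split => w //= _.
    by rewrite Ac.
  rewrite (_ : [set w | _] = set0) //; apply/seteqP; split => w //=.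
  by rewrite Ac A0.
rewrite (_ : [set w | _] =
   ([set w : config E | w e = true] `&` [set w : config E | A (upd w e true)]) `|`
   ([set w : config E | w e = false] `&` [set w : config E | A (upd w e false)])).
  by apply: measurableU; apply: measurableI; (exact: measurable_bit ||
    (apply: IH; exact: depends_upd dA)).
apply/seteqP; split => w /=.
  by move=> Aw; case we : (w e); [left|right]; rewrite -we upd_same.
by case=> -[<-]; rewrite upd_same.
Qed.

(* The bits of [t] have been fixed to [b], those of [s] remain to be fixed. *)
Let cylinder_Pr (p : R) (P : probability (config E) R) s t (b : E -> bool) A :
  bernoulli_product p P -> uniq (t ++ s) -> depends s A ->
  P [set w : config E | (forall i, i \in t -> w i = b i) /\ A w] =
  ((\prod_(e <- t) (if b e then p else 1 - p)) * Pr (fun=> p) s A)%:E.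
Proof.
move=> HP; elim: s t b A => [|e s IH] t b A.
  rewrite cats0 => ut dA; have Ac w : A w = A (fun=> false) by exact: dA.
  rewrite /Pr /=; case A0 : (A (fun=> false)).
    rewrite mulr1 -HP //; congr (P _).
    by apply/seteqP; split => w /= => [[]//|h]; rewrite Ac.
  rewrite mulr0 (_ : [set w | _] = set0) ?measure0 //.
  by apply/seteqP; split => w //= []; rewrite Ac A0.
move=> uts dA; have : uniq ((e :: t) ++ s) by move: uts; rewrite -cat1s uniq_catCA.
move=> uets; have et : e \notin t by move: uets => /= /andP[]; rewrite mem_cat negb_or => /andP[].
pose S c := [set w : config E | (forall i, i \in e :: t -> w i = upd b e c i) /\ A (upd w e c)].
have key (w : config E) c : S c w <->
    [/\ w e = c, forall i, i \in t -> w i = b i & A w].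
  split=> [[h Aw]|[we h Aw]].
    have we : w e = c by rewrite h ?inE ?eqxx // /upd eqxx.
    rewrite -we upd_same in Aw; split => // i it; rewrite h ?inE ?it ?orbT // /upd.
    by case: eqVneq it => // ->; rewrite (negbTE et).
  split; last by rewrite -we upd_same.
  move=> i; rewrite inE /upd; case: eqVneq => [->//|_ /=].
  exact: h.
have SE : [set w : config E | (forall i, i \in t -> w i = b i) /\ A w] = S true `|` S false.
  apply/seteqP; split => w.
    by move=> [h Aw]; case we : (w e); [left|right]; apply/key.
  by case=> /key[].
have mS c : measurable (S c).
  apply: measurableI; first exact: measurable_cylinder.
  exact: measurable_depends (depends_upd c dA).
have S0 : S true `&` S false = set0.
  by apply/seteqP; split => w // -[/key[wt _ _] /key[]]; rewrite wt.
have PS c : P (S c) = ((if c then p else 1 - p) *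
    (\prod_(i <- t) (if b i then p else 1 - p)) * Pr (fun=> p) s (fun w => A (upd w e c)))%:E.
  rewrite /S IH //; last exact: depends_upd dA.
  rewrite big_cons {1}/upd eqxx; congr ((_ * _ * _)%:E).
  apply: eq_big_seq => i it; rewrite /upd; case: eqVneq it => // ->.
  by rewrite (negbTE et).
transitivity (P (S true) + P (S false))%E; first by rewrite -measureU // SE.
rewrite !PS -EFinD /Pr /=; congr (_%:E); lra.
Qed.

Lemma bernoulli_Pr (p : R) (P : probability (config E) R) s A :
  bernoulli_product p P -> uniq s -> depends s A ->
  P [set w : config E | A w] = (Pr (fun=> p) s A)%:E.
Proof.
move=> HP us dA; have := cylinder_Pr (t := [::]) (fun=> true) HP us dA.
rewrite big_nil mul1r => <-; congr (P _).
by apply/seteqP; split => w //= [].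
Qed.

End BernoulliCylinders.

(** * Percolation on a graph whose edges are replaced *)

Lemma connect_invariant (T : finType) (e : rel T) (P : T -> Prop) x y :
  connect e x y -> P x -> (forall u v, P u -> e u v -> P v) -> P y.
Proof.
move=> /connectP[p pp ->] Px st; elim: p x pp Px => //= z p IH x /andP[xz pp] Px.
exact: IH pp (st _ _ Px xz).
Qed.

Section OpenSubgraph.
Variable G : ograph.
Implicit Types w : oedge G -> bool.

(** The relation [open_adj], for configurations that are plain functions. *)
Definition open_nbr w : rel (overt G) := fun x y =>
  [exists e : oedge G, w e && ((val e == (x, y)) || (val e == (y, x)))].

Definition linked w : rel (overt G) := connect (open_nbr w).

Definition crosses w : bool := linked w (osrc G) (otgt G).

Lemma open_nbrP w x y :
  reflect (exists2 e : oedge G, w e & val e = (x, y) \/ val e = (y, x)) (open_nbr w x y).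
Proof.
apply: (iffP existsP) => [[e /andP[we /orP[]/eqP ve]]|[e we ve]].
- by exists e => //; left.
- by exists e => //; right.
- by exists e; rewrite we /=; case: ve => ->; rewrite eqxx ?orbT.
Qed.

Lemma open_nbr_sym w : symmetric (open_nbr w).
Proof. by move=> x y; apply/open_nbrP/open_nbrP => -[e we [] ve]; exists e => //; [right|left|right|left]. Qed.

Lemma linked_sym w : symmetric (linked w).
Proof. exact: sym_connect_sym (open_nbr_sym w). Qed.

Lemma linked_trans w : transitive (linked w).
Proof. exact: connect_trans. Qed.

Lemma linked_refl w x : linked w x x.
Proof. exact: connect0. Qed.

Lemma linked_mono w w' x y : (forall e, w e -> w' e) -> linked w x y -> linked w' x y.
Proof.
move=> ww; apply: connect_sub => u v /open_nbrP[e we ve]; apply: connect1; apply/open_nbrP.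
by exists e => //; exact: ww.
Qed.

Lemma linked_edge w (e : oedge G) : w e -> linked w (val e).1 (val e).2.
Proof. by move=> we; apply: connect1; apply/open_nbrP; exists e => //; left; case: (val e). Qed.

Lemma linked_all w x y : (forall e, w e) -> linked w x y.
Proof.
move=> all_w; have := oarc_connected x y; apply: connect_sub => u v.
rewrite -/(linked w u v).
by move=> /= /orP[uv|vu]; [have := linked_edge (all_w (exist _ (u, v) uv))|
  rewrite linked_sym; have := linked_edge (all_w (exist _ (v, u) vu))].
Qed.

Lemma crosses_ffun (w : {ffun oedge G -> bool}) : crossing w = crosses w.
Proof. by []. Qed.

Lemma increasing_crosses : increasing_event crosses.
Proof. by move=> w w' ww; exact: linked_mono. Qed.

Lemma crossing_probE (R : realType) (p : R) :
  crossing_prob G p = Pr (fun=> p) (enum {: oedge G}) crosses.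
Proof.
rewrite /Pr Ex_ffun; last exact: depends_enum.
rewrite /crossing_prob big_mkcond /=; apply: eq_bigr => w _.
by rewrite -crosses_ffun; case: ifP; rewrite ?mulr1 ?mulr0.
Qed.

End OpenSubgraph.

Section Replacement.
Variables G H : ograph.
Implicit Types (w : oedge (replace G H) -> bool) (e : oedge G) (h : overt H).

Lemma mkedge_subproof (eg : oedge G * oedge H) :
  rarc (place eg.1 (val eg.2).1) (place eg.1 (val eg.2).2).
Proof.
apply/rarcP; exists eg.1, (val eg.2).1, (val eg.2).2; split => //; exact: (valP eg.2).
Qed.

Definition mkedge (eg : oedge G * oedge H) : oedge (replace G H) :=
  exist _ (place eg.1 (val eg.2).1, place eg.1 (val eg.2).2) (mkedge_subproof eg).

(** Two copies meet only at their terminals. *)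
Lemma place_eq e e' h h' : place e h = place e' h' ->
  (e = e' /\ h = h') \/
  exists i, [/\ place e h = inl i,
    (i = (val e).1 /\ h = osrc H) \/ (i = (val e).2 /\ h = otgt H) &
    (i = (val e').1 /\ h' = osrc H) \/ (i = (val e').2 /\ h' = otgt H)].
Proof.
case: (placeP e h) => [->|->|w ->]; case: (placeP e' h') => [->|->|w' ->] //.
- by case=> q; right; exists (val e).1; split; [|left|left].
- by case=> q; right; exists (val e).1; split; [|left|right].
- by case=> q; right; exists (val e).2; split; [|right|left].
- by case=> q; right; exists (val e).2; split; [|right|right].
- by case=> -> ->; left.
Qed.

Lemma place_inl e h i : place e h = inl i ->
  (i = (val e).1 /\ h = osrc H) \/ (i = (val e).2 /\ h = otgt H).
Proof. by case: placeP => [->|->|//] [->]; [left|right]. Qed.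

(** Copies of two distinct edges of [G] can only share an edge that joins terminals of [H],
   and then the asymmetry of the arcs excludes it. *)
Lemma mkedge_inj : injective mkedge.
Proof.
case=> e g [e' g'] eq1.
have q1 : place e (val g).1 = place e' (val g').1 by have := congr1 (fun x => (val x).1) eq1.
have q2 : place e (val g).2 = place e' (val g').2 by have := congr1 (fun x => (val x).2) eq1.
have gg : e = e' -> (e, g) = (e', g').
  move=> ee; rewrite -ee in q1 q2; rewrite -ee; congr (_, _); apply: val_inj.
  by rewrite (surjective_pairing (val g)) (surjective_pairing (val g')) (place_inj q1) (place_inj q2).
have ag := valP g; have ag' := valP g'.
case: (place_eq q1) => [[ee _]|[i [_ i1 i2]]]; first exact: gg.
case: (place_eq q2) => [[ee _]|[j [_ j1 j2]]]; first exact: gg.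
apply: gg => //; apply: val_inj; rewrite (surjective_pairing (val e)) (surjective_pairing (val e')).
move: i1 i2 j1 j2 ag ag' => [[i1 h1]|[i1 h1]] [[i2 h2]|[i2 h2]] [[j1 k1]|[j1 k1]] [[j2 k2]|[j2 k2]];
  rewrite h1 k1 h2 k2 => a a'; do ?[by have := oarc_neq a; rewrite eqxx | by have := oarc_neq a'; rewrite eqxx].
- by rewrite -i1 -i2 -j1 -j2.
- by have /negP := oarc_asym a; case.
- by have /negP := oarc_asym a; case.
- by rewrite -i1 -i2 -j1 -j2.
Qed.

Lemma mkedge_surj (e : oedge (replace G H)) : exists eg, e = mkedge eg.
Proof.
have /rarcP[e' [h [h' [hh q1 q2]]]] := valP e.
exists (e', exist _ (h, h') hh); apply: val_inj => /=.
by rewrite q1 q2 -surjective_pairing.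
Qed.

Definition unmk (e : oedge (replace G H)) : oedge G * oedge H :=
  sval (cid (mkedge_surj e)).

Lemma unmkK : cancel unmk mkedge.
Proof. by move=> e; rewrite /unmk; case: cid. Qed.

Lemma mkedgeK : cancel mkedge unmk.
Proof. by move=> eg; apply: mkedge_inj; rewrite unmkK. Qed.

Lemma card_oedge_replace : #|{: oedge (replace G H)}| = (#|{: oedge G}| * #|{: oedge H}|)%N.
Proof. by rewrite -card_prod; apply/esym/bij_eq_card; exists unmk; [exact: mkedgeK|exact: unmkK]. Qed.

Definition cell w e : oedge H -> bool := fun g => w (mkedge (e, g)).

(** The renormalized configuration. *)
Definition coarse w e : bool := crosses (cell w e).

(** The copies are disjoint, so the events [C e], each inside one copy, define again
   an independent configuration on [G]. *)
Lemma Pr_replace (R : realType) (x : oedge (replace G H) -> R)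
    (C : oedge G -> (oedge H -> bool) -> bool) (A : (oedge G -> bool) -> bool) :
  Pr x (enum {: oedge (replace G H)}) (fun w => A (fun e => C e (cell w e))) =
  Pr (fun e => Pr (fun g => x (mkedge (e, g))) (enum {: oedge H}) (C e))
    (enum {: oedge G}) A.
Proof.
pose s := [seq (e, g) | e <- enum {: oedge G}, g <- enum {: oedge H}].
have sall eg : eg \in s by apply/allpairsP; exists eg; rewrite !mem_enum; case: eg.
rewrite /Pr -(Ex_renorm (fun eg => x (mkedge eg))); last first.
- exact: depends_enum.
- by move=> e; exact: depends_enum.
rewrite -/s (@Ex_transport _ _ _ _ x mkedge s _
   (fun w => (A (fun e => C e (cell w e)))%:R)) //.
- symmetry; apply: Ex_enum => w w' ww; congr (A _)%:R; apply/funext => e; congr (C e _).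
  by apply/funext => g; apply: ww; apply: map_f.
- by rewrite (map_inj_uniq mkedge_inj) allpairs_uniq ?enum_uniq // => -[? ?] [? ?].
- move=> w w' ww; congr (A _)%:R; apply/funext => e; congr (C e _).
  by apply/funext => g; apply: ww.
Qed.

Lemma open_nbr_replace w u v : open_nbr w u v ->
  exists e h h', [/\ u = place e h, v = place e h' & open_nbr (cell w e) h h'].
Proof.
move=> /open_nbrP[f wf ve]; case: (mkedge_surj f) => -[e g] fE; rewrite fE in wf ve.
case: ve => /= -[<- <-]; [exists e, (val g).1, (val g).2|exists e, (val g).2, (val g).1];
  split => //; apply/open_nbrP; exists g => //; [left|right]; by case: (val g).
Qed.

Lemma linked_place w e h h' : linked (cell w e) h h' -> linked w (place e h) (place e h').
Proof.
move=> hh; apply: (connect_invariant (P := fun h' => linked w (place e h) (place e h')) hh).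
  exact: linked_refl.
move=> k k' hk /open_nbrP[g wg vg]; apply: linked_trans hk _; apply: connect1; apply/open_nbrP.
exists (mkedge (e, g)) => //=; case: vg => vg; [left|right]; by rewrite vg.
Qed.

Lemma linked_coarse w x y : linked (coarse w) x y -> linked w (inl x) (inl y).
Proof.
move=> xy; apply: (connect_invariant (P := fun y => linked w (inl x) (inl y)) xy).
  exact: linked_refl.
move=> k k' xk /open_nbrP[e we ve]; apply: linked_trans xk _.
have := linked_place we; rewrite place_src place_tgt.
by case: ve => -> //=; rewrite linked_sym.
Qed.

(** The invariant followed along an open path of the replaced graph: the last old
   vertex [z] reached, up to coarse connections, and the piece of path since then,
   which stays in one copy. *)
Definition locally_linked w (z : overt G) (u : overt (replace G H)) : Prop :=
  u = inl z \/ exists e h, u = place e h /\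
    (z = (val e).1 /\ linked (cell w e) (osrc H) h \/
     z = (val e).2 /\ linked (cell w e) (otgt H) h).

Lemma locally_linked_inl w z x : locally_linked w z (inl x) -> linked (coarse w) z x.
Proof.
case=> [[->]|[e [h [/esym/place_inl xh zh]]]]; first exact: linked_refl.
have cE : coarse w e -> linked (coarse w) (val e).1 (val e).2 by exact: linked_edge.
case: zh xh => -[-> lh] [] [-> hE]; rewrite hE in lh; try exact: linked_refl.
  exact: cE.
by rewrite linked_sym; apply: cE; rewrite /coarse /crosses linked_sym.
Qed.

(** Conversely to [linked_coarse], an open path between old vertices crosses one
   copy after another. *)
Lemma linked_locally w x u : linked w (inl x) u ->
  exists2 z, linked (coarse w) x z & locally_linked w z u.
Proof.
move=> xu; apply: (connect_invariant (P := fun u =>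
   exists2 z, linked (coarse w) x z & locally_linked w z u) xu).
  by exists x; [exact: linked_refl|left].
move=> {xu}u v [z xz zu] /open_nbr_replace[e [h [h' [uE vE hh]]]].
have l1 a : linked (cell w e) a h -> linked (cell w e) a h'.
  by move=> ah; apply: linked_trans ah (connect1 hh).
case: u uE zu => [y yE zy|[e2 k] kE zu].
  exists y; first by apply: linked_trans xz _; exact: locally_linked_inl.
  right; exists e, h'; split => //.
  case: (place_inl (esym yE)) => -[-> hE]; [left|right]; split => //; apply: l1; rewrite hE; exact: linked_refl.
exists z => //; case: zu => // -[e' [k' [k'E zk]]]; right; exists e, h'; split => //.
have : place e' k' = place e h by rewrite -k'E.
case/place_eq => [[ee kk]|[i [ie _ _]]]; last by move: k'E; rewrite ie.
rewrite ee kk in zk.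
by case: zk => -[-> ?]; [left|right]; split => //; apply: l1.
Qed.

End Replacement.

(** * Escaping from a ball *)

Section Escape.
Variable G : ograph.

Definition within_dist (n : nat) (x y : overt G) : Prop :=
  exists2 p, walk (@oadj G) x y p & (size p <= n)%N.

Lemma within_dist_refl n x : within_dist n x x.
Proof. by exists [::] => //; rewrite /walk /= eqxx. Qed.

Lemma within_dist_trans m n x y z : within_dist m x y -> within_dist n y z -> within_dist (m + n) x z.
Proof.
move=> [p /andP[pp /eqP lp] sp] [q /andP[qq /eqP lq] sq]; exists (p ++ q).
  by rewrite /walk cat_path last_cat lp pp qq lq eqxx.
by rewrite size_cat leq_add.
Qed.

Lemma within_dist_le m n x y : (m <= n)%N -> within_dist m x y -> within_dist n x y.
Proof. by move=> mn [p wp sp]; exists p => //; exact: leq_trans mn. Qed.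

Lemma within_dist_card x y : within_dist #|overt G| x y.
Proof.
have /connectP[p pp ->] := oarc_connected x y.
case: (shortenP pp) => q qq uq _; exists q; first by rewrite /walk qq eqxx.
by have /= q1 := card_uniqP uq; apply: leq_trans (leqnSn _) _; rewrite -q1; exact: max_card.
Qed.

Definition edge_ball (e : oedge G) (r : nat) (v : overt G) : Prop :=
  within_dist r (val e).1 v \/ within_dist r (val e).2 v.

Definition escapes (e : oedge G) (r : nat) (w : oedge G -> bool) : bool :=
  `[< exists s v, [/\ s = (val e).1 \/ s = (val e).2, linked w s v & ~ edge_ball e r v] >].

Definition incident (x : overt G) : {set oedge G} :=
  [set e : oedge G | ((val e).1 == x) || ((val e).2 == x)].

Definition deg (x : overt G) : nat := #|incident x|.

Lemma linked_incident (w : oedge G -> bool) s v : linked w s v -> s != v ->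
  exists2 f, w f & f \in incident s.
Proof.
move=> /connectP[[|z p] /= pp ->]; first by rewrite eqxx.
move: pp => /andP[/open_nbrP[f wf vf] _] _; exists f => //.
by rewrite inE; case: vf => ->; rewrite eqxx ?orbT.
Qed.

(** To leave the root edge, the cluster needs an open edge at one of its
   endpoints. *)
Lemma Pr_escapes0 (R : realType) (q : R) e : 0 <= q <= 1 ->
  Pr (fun=> q) (enum {: oedge G}) (escapes e 0) <=
  q * (deg (val e).1 + deg (val e).2)%:R.
Proof.
move=> q01; have x01 : forall e : oedge G, 0 <= (fun=> q) e <= 1 by [].
pose I := incident (val e).1 :|: incident (val e).2.
apply: (le_trans (@Pr_exists _ _ _ x01 _ _ _ (fun f w => (f \in I) && w f) _)).
  move=> w /asboolP[s [v [se sv far]]].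
  have sNv : s != v.
    apply/eqP => sE; apply: far; rewrite -sE; case: se => ->; [left|right]; exact: within_dist_refl.
  have [f wf fs] := linked_incident sv sNv.
  by exists f; rewrite wf andbT finset.in_setU; case: se fs => -> ->; rewrite ?orbT.
rewrite (bigID (mem I)) /= [X in _ + X]big1 => [|f /negbTE fI]; last first.
  by rewrite -[RHS](Ex_const (fun=> q) (enum {: oedge G})); apply: eq_Ex => w; rewrite fI.
rewrite addr0 (eq_bigr (fun=> q)) => [|f fI]; last first.
  transitivity (Pr (fun=> q) (enum {: oedge G}) (fun w => w f && true)).
    by apply: eq_Ex => w; rewrite fI andbT.
  by rewrite Pr_and_true ?mem_enum // /Pr Ex_const mulr1.
have /andP[q0 _] := q01; rewrite sumr_const -[X in X <= _]mulr_natr ler_wpM2l ?ler_nat //.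
by rewrite /I cardsU leq_subr.
Qed.

End Escape.

Section ReplacementGeometry.
Variables G H : ograph.
Implicit Types (w : oedge (replace G H) -> bool) (e : oedge G) (g : oedge H).

Lemma within_dist_place n e (h h' : overt H) : within_dist n h h' ->
  @within_dist (replace G H) n (place e h) (place e h').
Proof.
case=> p /andP[pp /eqP <-] sp; exists (map (place e) p); last by rewrite size_map.
rewrite /walk last_map eqxx andbT.
elim: p h pp {sp} => //= z p IH h /andP[hz pp]; rewrite IH // andbT /oadj /=.
by case/orP: hz => hz; apply/orP; [left|right]; apply/rarcP;
  [exists e, h, z|exists e, z, h].
Qed.

Lemma within_dist_terminals e (x y : overt G) : ((val e).1 == x) || ((val e).2 == x) ->
  ((val e).1 == y) || ((val e).2 == y) ->
  @within_dist (replace G H) #|overt H| (inl x) (inl y).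
Proof.
have S := @place_src G H e; have T := @place_tgt G H e.
have W h h' := within_dist_place e (within_dist_card h h').
by move=> /orP[]/eqP <- /orP[]/eqP <-; rewrite -?S -?T.
Qed.

Lemma within_dist_inl n (x y : overt G) : within_dist n x y ->
  @within_dist (replace G H) (#|overt H| * n) (inl x) (inl y).
Proof.
case=> p /andP[pp /eqP <-]; elim: p x n pp => [|z p IH] x n /=.
  by move=> _ _; exact: within_dist_refl.
move=> /andP[xz pp]; case: n => // n pn; rewrite mulnS.
apply: within_dist_trans (IH _ _ pp pn); rewrite /= in xz.
by case/orP: xz => xz; [pose e : oedge G := exist _ (x, z) xz|
   pose e : oedge G := exist _ (z, x) xz]; apply: (@within_dist_terminals e);
   rewrite /= eqxx ?orbT.
Qed.

(** A copy has diameter less than [#|overt H|], so an open cluster leaving a large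
   ball leaves the copy around the root through a terminal, and then crosses copies
   up to an old vertex far from the coarse root. The radius counts one copy at
   the root, [r] copies on the way, and one copy at the end. *)
Lemma escapes_replace e g r w :
  escapes (mkedge (e, g)) (#|overt H| * (r + 2)) w -> escapes e r (coarse w).
Proof.
set D := #|overt H|; move=> /asboolP[s [v [sE sv far]]].
have root_near h : @within_dist (replace G H) D (place e (val g).1) (place e h).
  by apply: within_dist_place; exact: within_dist_card.
have [h0 sh0] : exists h0, s = place e h0.
  by case: sE => ->; [exists (val g).1|exists (val g).2].
have out : (exists h, v = place e h) \/
    exists2 i, i = (val e).1 \/ i = (val e).2 & linked w (inl i) v.
  apply: (connect_invariant (P := fun v => (exists h, v = place e h) \/
    exists2 i, i = (val e).1 \/ i = (val e).2 & linked w (inl i) v) sv).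
    by left; exists h0.
  move=> a b [[h aE]|[i ie ia]] ab; last by right; exists i => //; exact: linked_trans ia (connect1 ab).
  case/open_nbr_replace: (ab) => e' [k [k' [ak bk kk]]].
  have : place e h = place e' k by rewrite -aE.
  case/place_eq => [[ee _]|[i [hi [[ie _]|[ie _]] _]]]; first by left; exists k'; rewrite ee.
    by right; exists i; [left|rewrite -hi -aE; exact: connect1].
  by right; exists i; [right|rewrite -hi -aE; exact: connect1].
case: out => [[h vE]|[i ie iv]].
  case: far; left; rewrite vE; apply: within_dist_le (root_near h).
  by rewrite leq_pmulr // addn2.
have [z iz zv] := linked_locally iv.
apply/asboolP; exists i, z; split => // zr; apply: far; left.
have zv' : @within_dist (replace G H) D (inl z) v.
  case: zv => [->|[e' [h [-> zh]]]]; first exact: within_dist_refl.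
  case: zh => -[-> _]; rewrite -?(place_src H) -?(place_tgt H); apply: within_dist_place;
    exact: within_dist_card.
have -> : (D * (r + 2) = D + (D * r + D))%N by rewrite mulnDr muln2 -addnn addnCA addnA.
case: zr => /within_dist_inl zr; apply: within_dist_trans (within_dist_trans zr zv').
  by have := root_near (osrc H); rewrite place_src.
by have := root_near (otgt H); rewrite place_tgt.
Qed.

Lemma deg_inl (x : overt G) : (@deg (replace G H) (inl x) <= deg x * #|{: oedge H}|)%N.
Proof.
rewrite /deg -(card_imset _ (can_inj (@unmkK G H))) -cardsT -cardsX.
apply: subset_leq_card; apply/fintype.subsetP => _ /imsetP[f fx ->].
case: (mkedge_surj f) fx => -[e g] ->; rewrite mkedgeK !inE /= andbT.
by case/orP => /eqP/place_inl[] [-> _]; rewrite eqxx ?orbT.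
Qed.

Lemma deg_inr (ew : oedge G * inner H) : (@deg (replace G H) (inr ew) <= #|{: oedge H}|)%N.
Proof.
rewrite /deg -(card_imset _ (can_inj (@unmkK G H))) -[X in (_ <= X)%N]mul1n.
rewrite -(cards1 ew.1) -cardsT -cardsX.
apply: subset_leq_card; apply/fintype.subsetP => _ /imsetP[f fx ->].
case: (mkedge_surj f) fx => -[e g] ->; rewrite mkedgeK !inE /= andbT.
by case/orP; case: placeP => // w' _ /eqP[<-].
Qed.

End ReplacementGeometry.

(** * Tightness of degrees *)

Section HighDegree.
Local Close Scope classical_set_scope.

(** An edge with two such endpoints counts twice: the number of half-edges of high
   degree contracts under a single replacement, which may fail for edges, for
   instance when all the edges of [G_1] have a terminal as an endpoint. *)
Definition high (G : ograph) (M : nat) : nat :=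
  (#|[set e : oedge G | M < deg (val e).1]%SET| + #|[set e : oedge G | M < deg (val e).2]%SET|)%N.

Lemma high_le (G : ograph) M : (high G M <= 2 * #|{: oedge G}|)%N.
Proof. by rewrite mul2n -addnn leq_add // max_card. Qed.

Variables G H : ograph.
Hypothesis no_chord : ~~ oadj (osrc H) (otgt H).

(** Since [b] is not adjacent to [a], an edge at [b] avoids [a]. *)
Lemma edge_off (a b : overt H) : a != b -> ~~ oadj a b ->
  exists g : oedge H, ((val g).1 != a) && ((val g).2 != a).
Proof.
move=> ab nab; have /connectP[[|z p] /=] := oarc_connected b a.
  by move=> _ ba; rewrite ba eqxx in ab.
move=> /andP[bz _] _.
have za : z != a by apply: contra nab => /eqP <-; rewrite oadj_sym.
case/orP: bz => bz; [exists (exist _ (b, z) bz)|exists (exist _ (z, b) bz)];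
  by rewrite /= za eq_sym ab.
Qed.

Lemma card_at (a b : overt H) : a != b -> ~~ oadj a b ->
  (#|[set g : oedge H | (val g).1 == a]%SET| + #|[set g : oedge H | (val g).2 == a]%SET| <=
   #|{: oedge H}|.-1)%N.
Proof.
move=> ab nab; have [g gN] := edge_off ab nab.
rewrite -cardsUI (_ : (_ :&: _)%SET = finset.set0) ?cards0 ?addn0; last first.
  apply/finset.setP => f; rewrite !inE; apply/negP => /andP[/eqP f1 /eqP f2].
  by have := oarc_neq (valP f); rewrite f1 f2 eqxx.
rewrite -(cardsC1 g); apply: subset_leq_card; apply/fintype.subsetP => f.
by rewrite !inE; apply: contraTneq => ->; rewrite negb_or.
Qed.

(** A half-edge of the replaced graph has high degree only if it sits at a
   terminal of its copy, over an endpoint of high degree. Each terminal of [H] is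
   avoided by some edge, which gives the factor [m.-1] instead of [m]. *)
Lemma high_replace M : (0 < M)%N ->
  (high (replace G H) (M * #|{: oedge H}|) <= #|{: oedge H}|.-1 * high G M)%N.
Proof.
move=> M0; set m := #|{: oedge H}|.
pose B1 := [set e : oedge G | M < deg (val e).1]%N%SET.
pose B2 := [set e : oedge G | M < deg (val e).2]%N%SET.
pose a1 := [set g : oedge H | (val g).1 == osrc H]%SET.
pose a2 := [set g : oedge H | (val g).2 == osrc H]%SET.
pose b1 := [set g : oedge H | (val g).1 == otgt H]%SET.
pose b2 := [set g : oedge H | (val g).2 == otgt H]%SET.
have place_high e h : (M * m < @deg (replace G H) (place e h))%N ->
    (e \in B1) && (h == osrc H) || (e \in B2) && (h == otgt H).
  have lt_of (x : overt G) : (M * m < @deg (replace G H) (inl x))%N -> (M < deg x)%N.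
    move=> /leq_trans/(_ (deg_inl H x)); rewrite -/m ltn_mul2r => /andP[//].
  case: placeP => [->|->|w' _]; rewrite !inE.
  - by move=> /lt_of ->; rewrite eqxx.
  - by move=> /lt_of ->; rewrite eqxx orbT.
  - move=> /leq_trans/(_ (deg_inr (e, w'))).
    by rewrite -/m ltnNge -[X in (X <= _)%N]mul1n leq_mul2r M0 orbT.
have bound (i : oedge H -> overt H) (end_i : oedge (replace G H) -> overt (replace G H)) :
    (forall e g, end_i (mkedge (e, g)) = place e (i g)) ->
    (#|[set f : oedge (replace G H) | M * m < deg (end_i f)]%SET| <=
     #|B1| * #|[set g | i g == osrc H]%SET| + #|B2| * #|[set g | i g == otgt H]%SET|)%N.
  move=> iE; rewrite -(card_imset _ (can_inj (@unmkK G H))) -!cardsX.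
  apply: (@leq_trans #|(finset.setX B1 [set g | i g == osrc H]%SET :|:
     finset.setX B2 [set g | i g == otgt H]%SET)%SET|); last by rewrite cardsU leq_subr.
  apply: subset_leq_card; apply/fintype.subsetP => _ /imsetP[f fx ->].
  case: (mkedge_surj f) fx => -[e g] ->; rewrite mkedgeK inE iE => /place_high.
  by rewrite !inE.
have st := osrc_neq_otgt H.
have ha := card_at st no_chord.
have hb : (#|b1| + #|b2| <= m.-1)%N.
  by apply: (card_at (b := osrc H)); rewrite ?(eq_sym (otgt H)) // oadj_sym.
apply: (@leq_trans (#|B1| * (#|a1| + #|a2|) + #|B2| * (#|b1| + #|b2|))%N).
  rewrite !mulnDr addnACA; apply: leq_add.
    exact: (bound (fun g => (val g).1) (fun f => (val f).1)).
  exact: (bound (fun g => (val g).2) (fun f => (val f).2)).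
by rewrite /high [X in (_ <= X)%N]mulnDr ![(m.-1 * _)%N]mulnC leq_add // leq_mul2l ?ha ?hb orbT.
Qed.

End HighDegree.

(** * Joining the root to far terminals *)

Section Potential.

(** A certificate that the terminals are at distance at least [L]. *)
Definition potential (G : ograph) (phi : overt G -> nat) (L : nat) : Prop :=
  [/\ phi (osrc G) = 0%N, phi (otgt G) = L &
      forall x y, oarc x y -> (phi x <= phi y + 1)%N /\ (phi y <= phi x + 1)%N].

Lemma potential_within (G : ograph) (phi : overt G -> nat) L n (x y : overt G) : potential phi L ->
  within_dist n x y -> (phi x <= phi y + n)%N /\ (phi y <= phi x + n)%N.
Proof.
move=> [_ _ lip] [p /andP[pp /eqP <-]]; elim: p x n pp => [|z p IH] x n /=.
  by move=> _ _; rewrite !leq_addr.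
move=> /andP[xz pp]; case: n => // n pn; have [h1 h2] := IH _ _ pp pn.
have [k1 k2] : (phi x <= phi z + 1)%N /\ (phi z <= phi x + 1)%N.
  by case/orP: xz => /lip[].
split; rewrite -addn1.
- by rewrite addnA; apply: leq_trans k1 _; rewrite leq_add2r.
- by apply: leq_trans h2 _; rewrite [(n + 1)%N]addnC addnA leq_add2r.
Qed.

(** The potential of a replaced graph doubles the old one at the old vertices
   and takes the mean at the new ones, because [H] has no edge between its
   terminals. *)
Lemma potential_replace (G H : ograph) (phi : overt G -> nat) L : ~~ oadj (osrc H) (otgt H) ->
  potential phi L -> exists psi, @potential (replace G H) psi (2 * L).
Proof.
move=> nc [p0 pL lip].
pose psi (u : overt (replace G H)) : nat := match u with
  | inl x => (2 * phi x)%N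
  | inr (e, _) => (phi (val e).1 + phi (val e).2)%N
  end.
exists psi; split; rewrite /= ?p0 ?pL // => u v /rarcP[e [h [h' [hh <- <-]]]].
have [/= l1 l2] := lip _ _ (valP e).
case: (placeP e h) hh => [->|->|w ->]; case: (placeP e h') => [->|->|w' ->] hh /=;
  try by [exfalso; have := oarc_neq hh; rewrite eqxx];
  try by [move: nc; rewrite /oadj /= hh ?orbT];
  split; lia.
Qed.

End Potential.

Section Joining.
Variable G : ograph.

(** With the root edge required to be open, the event on a coarse graph fixes the
   state of the copy around the root, see [Pr_joins_replace]. *)
Definition joins (e : oedge G) (w : oedge G -> bool) : bool :=
  w e && (linked w (val e).1 (osrc G) && linked w (val e).1 (otgt G)).

(** One of the two terminals is outside of the ball, as they are far apart. *)
Lemma joins_escapes (phi : overt G -> nat) L (e : oedge G) r w :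
  potential phi L -> (2 * r + 2 < L)%N -> joins e w -> escapes e r w.
Proof.
move=> pot rL /and3P[_ ls lt].
have [p0 pL lip] := pot; have [/= l1 l2] := lip _ _ (valP e).
have [ns|/asboolP ns] := pselect (edge_ball e r (osrc G)); last first.
  by apply/asboolP; exists (val e).1, (osrc G); split => //; [left|apply/asboolP].
have [nt|/asboolP nt] := pselect (edge_ball e r (otgt G)); last first.
  by apply/asboolP; exists (val e).1, (otgt G); split => //; [left|apply/asboolP].
have A v : edge_ball e r v -> (phi v <= phi (val e).1 + 1 + r)%N /\ (phi (val e).1 <= phi v + r + 1)%N.
  rewrite /=; case=> /(potential_within pot) /= []; lia.
by move: (A _ ns) (A _ nt) => /=; lia.
Qed.

End Joining.

Section JoiningReplacement.
Variables (R : realType) (G H : ograph).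

Lemma Ex_upd_indep (E : eqType) (x y : E -> R) (s : seq E) e b (F : (E -> bool) -> R) :
  (forall e', e' != e -> x e' = y e') ->
  Ex x s (fun w => F (upd w e b)) = Ex y s (fun w => F (upd w e b)).
Proof.
move=> xy; elim: s F => //= e' s IH F; have [->|ne] := eqVneq e' e.
  have K c : (fun w => F (upd (upd w e c) e b)) = (fun w => F (upd w e b)).
    by apply/funext => w; rewrite updK.
  rewrite !K IH; lra.
have K c : (fun w => F (upd (upd w e' c) e b)) = (fun w => F (upd (upd w e b) e' c)).
  by apply/funext => w; rewrite updC.
rewrite !K xy //.
by rewrite (IH (fun v => F (upd v e' true))) (IH (fun v => F (upd v e' false))).
Qed.

Lemma Pr_all (E : eqType) (p : R) (s t : seq E) : 0 <= p <= 1 -> {subset t <= s} -> uniq t ->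
  Pr (fun=> p) s (fun w => all w t) = p ^+ size t.
Proof.
move=> p01; elim: t => [|e t IH] ts /=; first by rewrite /Pr Ex_const expr0.
move=> /andP[et ut].
have -> : Pr (fun=> p) s (fun w => w e && all w t) =
    p * Pr (fun=> p) s (fun w => all (upd w e true) t).
  by rewrite Pr_and_true //; apply: ts; rewrite inE eqxx.
rewrite exprS -IH //; last by move=> i it; apply: ts; rewrite inE it orbT.
congr (_ * Ex _ _ _); apply/funext => w; congr (_%:R); congr nat_of_bool.
by apply: eq_in_all => i it; rewrite /upd; case: eqVneq it => // ->; rewrite (negbTE et).
Qed.

(** If the copy around the root is fully open, the root inherits the connections
   of its coarse edge. *)
Lemma joins_replace (e : oedge G) (g : oedge H) (w : oedge (replace G H) -> bool) :
  joins e (fun e' => if e' == e then [forall f, cell w e f] else coarse w e') ->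
  joins (mkedge (e, g)) w.
Proof.
set w' := fun e' => _; rewrite /joins {1}/w' eqxx => /and3P[/forallP all_e ls lt].
have ww e' : w' e' -> coarse w e'.
  by rewrite /w'; case: eqVneq => // -> _; exact: linked_all.
have root : linked w (place e (val g).1) (inl (val e).1).
  by rewrite -(place_src H); apply: linked_place; exact: linked_all.
apply/and3P; split; first exact: (all_e g).
  by apply: linked_trans root _; apply: linked_coarse; exact: linked_mono ls.
by apply: linked_trans root _; apply: linked_coarse; exact: linked_mono lt.
Qed.

(** The copy around the root is fully open with probability [p ^+ m], independently
   of the other copies. Replacing its crossing by this smaller event changes the
   parameter of one edge, the root edge, on which the coarse event is linear. *)
Lemma Pr_joins_replace (p : R) (e : oedge G) (g : oedge H) : 0 <= p <= 1 ->
  p ^+ #|{: oedge H}| *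
    Pr (fun=> crossing_prob H p) (enum {: oedge G}) (joins e) <=
  Pr (fun=> p) (enum {: oedge (replace G H)}) (joins (mkedge (e, g))).
Proof.
move=> p01; have x01 (E : eqType) : forall i : E, 0 <= (fun=> p) i <= 1 by [].
apply: le_trans (Pr_le (x01 _) _ (fun w => @joins_replace e g w)).
rewrite crossing_probE; set f := Pr _ _ (@crosses H).
have f01 : 0 <= f <= 1 by rewrite Pr_ge0 ?Pr_le1.
pose C e' (h : oedge H -> bool) := if e' == e then [forall i, h i] else crosses h.
rewrite (_ : (fun w => _) = (fun w => joins e (fun e' => C e' (cell w e')))); last first.
  apply/funext => w; congr (joins e _); apply/funext => e'; rewrite /C.
  by case: eqVneq => // ->.
rewrite (Pr_replace (fun=> p)).
set y := fun e' => Pr _ _ (C e').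
have ye : y e = p ^+ #|{: oedge H}|.
  rewrite cardE -(@Pr_all _ p (enum {: oedge H}) _ p01) ?enum_uniq //.
  rewrite /y /C eqxx; congr (Ex _ _ _); apply/funext => h; congr (_%:R); congr nat_of_bool.
  by apply/forallP/allP => [hh i _|hh i]; [exact: hh|apply: hh; rewrite mem_enum].
have yf e' : e' != e -> y e' = f by rewrite /y /C => /negbTE ->.
rewrite /joins !Pr_and_true ?mem_enum // ye.
rewrite ler_wpM2l ?exprn_ge0 //; first by case/andP: p01.
rewrite [X in _ <= X](_ : _ = Pr (fun=> f) (enum {: oedge G})
  (fun w => linked (upd w e true) (val e).1 (osrc G) && linked (upd w e true) (val e).1 (otgt G))).
  by rewrite ler_piMl ?Pr_ge0 //; case/andP: f01.
exact: (@Ex_upd_indep _ y (fun=> f) _ e true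
  (fun w => (linked w (val e).1 (osrc G) && linked w (val e).1 (otgt G))%:R) yf).
Qed.

End JoiningReplacement.

(** * The crossing probability and its fixed point *)

Section CrossingBounds.
Variables (R : realType) (H : ograph).
Implicit Types w : oedge H -> bool.

Lemma sum_pairs_le (E : finType) (c : R) (B : E * E -> R) :
  0 <= c -> (forall i, B i <= c) -> \sum_i B i <= (#|E| ^ 2)%:R * c.
Proof.
move=> c0 Bc; rewrite mulr_natl -mulnn -card_prod -sumr_const.
exact: ler_sum.
Qed.

(** A crossing uses an open edge at each terminal, and these two edges are distinct
   because no edge joins the terminals. *)
Lemma crossing_prob_small (p : R) : ~~ oadj (osrc H) (otgt H) -> 0 <= p <= 1 ->
  crossing_prob H p <= (#|{: oedge H}| ^ 2)%:R * p ^+ 2.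
Proof.
move=> nc p01; have x01 : forall e : oedge H, 0 <= (fun=> p) e <= 1 by [].
rewrite crossing_probE.
apply: le_trans (@Pr_exists _ _ _ x01 _ _ _
    (fun (i : oedge H * oedge H) w => w i.1 && ((i.1 != i.2) && w i.2)) _) _.
  move=> w cr; have [f wf fs] := linked_incident cr (osrc_neq_otgt H).
  have ts : otgt H != osrc H by rewrite eq_sym osrc_neq_otgt.
  have [g wg gt] := @linked_incident _ w _ _ (etrans (linked_sym w _ _) cr) ts.
  exists (f, g); rewrite /= wf wg andbT; apply/eqP => fg.
  have st := osrc_neq_otgt H; have af := valP f.
  move: nc fs gt; rewrite -fg !inE /oadj /=.
  by move=> nc /orP[]/eqP fs /orP[]/eqP ft; move: nc st; rewrite -fs -ft ?eqxx ?af ?orbT.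
apply: sum_pairs_le => [|[f g] /=]; first by rewrite exprn_ge0 //; case/andP: p01.
rewrite Pr_and_true ?mem_enum // expr2 ler_wpM2l //; first by case/andP: p01.
have [->|fg] := eqVneq f g.
  by rewrite /Pr Ex_const; case/andP: p01.
apply: le_trans (_ : Pr (fun=> p) (enum {: oedge H}) (fun w => w g && true) <= _).
  apply: (Pr_le x01) => w; rewrite /upd [g == f]eq_sym (negbTE fg).
  by case: (w g).
by rewrite Pr_and_true ?mem_enum // /Pr Ex_const mulr1.
Qed.

Lemma linked_or_closed w x p : path (@oadj H) x p ->
  linked w x (last x p) \/
  exists2 f : oedge H, ~~ w f & on_path x p (val f).1 (val f).2.
Proof.
elim: p x => [|z p IH] x /=; first by left; exact: linked_refl.
move=> /andP[xz /IH zp].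
have [f vf] : exists f : oedge H, val f = (x, z) \/ val f = (z, x).
  by case/orP: xz => xz; [exists (exist _ (x, z) xz); left|exists (exist _ (z, x) xz); right].
have [wf|nwf] := boolP (w f); last first.
  by right; exists f => //; rewrite /on_path /=; case: vf => ->; rewrite !inE eqxx ?orbT.
case: zp => [zp|[g wg zp]]; [left|right].
  by apply: linked_trans zp; apply: connect1; apply/open_nbrP; exists f.
by exists g => //; move: zp; rewrite /on_path /= !inE => /orP[] ->; rewrite ?orbT.
Qed.

(** Without a crossing, each of two edge-disjoint paths has a closed edge, and
   these two edges are distinct. *)
Lemma crossing_prob_large (p : R) : two_edge_disjoint_paths H -> 0 <= p <= 1 ->
  1 - crossing_prob H p <= (#|{: oedge H}| ^ 2)%:R * (1 - p) ^+ 2.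
Proof.
move=> [p1 [p2 [/andP[/andP[pp1 /eqP l1] _] /andP[/andP[pp2 /eqP l2] _] dis]]] p01.
have x01 : forall e : oedge H, 0 <= (fun=> p) e <= 1 by [].
have q0 : 0 <= 1 - p by rewrite subr_ge0; case/andP: p01.
rewrite crossing_probE -PrN.
apply: le_trans (@Pr_exists _ _ _ x01 _ _ _
    (fun (i : oedge H * oedge H) w => ~~ w i.1 && ((i.1 != i.2) && ~~ w i.2)) _) _.
  move=> w ncr.
  have [|[f wf fp]] := linked_or_closed w pp1.
    by rewrite l1 => cr; move: ncr; rewrite /crosses cr.
  have [|[g wg gp]] := linked_or_closed w pp2.
    by rewrite l2 => cr; move: ncr; rewrite /crosses cr.
  exists (f, g); rewrite /= wf wg andbT; apply/eqP => fg.
  by have /negP := dis _ _ fp; rewrite fg.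
apply: sum_pairs_le => [|[f g] /=]; first by rewrite exprn_ge0.
rewrite Pr_and_false ?mem_enum // expr2 ler_wpM2l //.
have [->|fg] := eqVneq f g; first by rewrite /Pr Ex_const.
apply: le_trans (_ : Pr (fun=> p) (enum {: oedge H}) (fun w => ~~ w g && true) <= _).
  apply: (Pr_le x01) => w; rewrite /upd [g == f]eq_sym (negbTE fg).
  by case: (w g).
by rewrite Pr_and_false ?mem_enum // /Pr Ex_const mulr1.
Qed.

End CrossingBounds.

Section SShape.
Variables (R : realType) (P : {poly R}) (C : R).
Let f p := P.[p].
Hypothesis C1 : 1 <= C.
Hypothesis f01 : forall p, 0 <= p <= 1 -> 0 <= f p <= 1.
Hypothesis f_small : forall p, 0 <= p <= 1 -> f p <= C * p ^+ 2.
Hypothesis f_large : forall p, 0 <= p <= 1 -> 1 - f p <= C * (1 - p) ^+ 2.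
Hypothesis f_odds : forall p q, 0 < p -> p <= q -> q < 1 ->
  q * (1 - p) * (f p * (1 - f q)) <= p * (1 - q) * (f q * (1 - f p)).

(* A point close to 0 where the quadratic bounds beat the identity, at [d] and at
   [1 - d]. *)
Let d := (C + 1)^-1.

Let d_gt0 : 0 < d. Proof. by rewrite invr_gt0; have := C1; lra. Qed.
Let Cd : C * d = 1 - d.
Proof.
have h : (C + 1) * d = 1 by rewrite mulfV //; apply/eqP; have := C1; lra.
move: h; rewrite mulrDl; lra.
Qed.
Let d_le : d <= 1 / 2.
Proof. have : 1 * d <= C * d by rewrite ler_wpM2r // ltW. rewrite Cd; lra. Qed.

Let f_below : f d < d.
Proof.
have h := d_gt0; have h2 := d_le; apply: le_lt_trans (f_small _) _; first lra.
rewrite expr2 mulrA Cd mulrBl mul1r ltrBlDr ltrDl; exact: mulr_gt0.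
Qed.

Let f_above : 1 - d < f (1 - d).
Proof.
have h := d_gt0; have h2 := d_le.
have b : 1 - f (1 - d) <= C * (1 - (1 - d)) ^+ 2 by apply: f_large; lra.
have a : C * d ^+ 2 < d by rewrite expr2 mulrA Cd mulrBl mul1r ltrBlDr ltrDl; exact: mulr_gt0.
have e : 1 - (1 - d) = d by lra.
rewrite e in b; lra.
Qed.

Lemma fixed_point_exists : exists p, 0 < p < 1 /\ f p = p.
Proof.
have h := d_gt0; have h2 := d_le; have fa := f_above; have fb := f_below.
have [||c /andP[c1 c2]] := @poly_ivt R (P - 'X) d (1 - d); first lra.
  by rewrite !hornerE; rewrite /f in fa fb; apply/andP; split; lra.
rewrite /root !hornerE subr_eq0 => /eqP fc; exists c; split => //.
by apply/andP; split; lra.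
Qed.

(** Between two fixed points the odds inequality, applied at both ends, leaves
   only the identity, and a polynomial cannot be the identity on a segment without
   being so at [d]. *)
Lemma fixed_point_unique p q : 0 < p -> p < q -> q < 1 -> f p = p -> f q = q -> False.
Proof.
move=> p0 pq q1 fp fq.
have id_on r : p <= r -> r <= q -> f r = r.
  move=> pr rq; apply/eqP; rewrite eq_le; apply/andP; split.
    have := f_odds (lt_le_trans p0 pr) rq q1; rewrite fq => o.
    have {}o : (q * (1 - q)) * ((1 - r) * f r) <= (q * (1 - q)) * (r * (1 - f r)) by lra.
    by rewrite ler_pM2l ?mulr_gt0 in o; lra.
  have := f_odds p0 pr (le_lt_trans rq q1); rewrite fp => o.
  have {}o : (p * (1 - p)) * (r * (1 - f r)) <= (p * (1 - p)) * ((1 - r) * f r) by lra.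
  by rewrite ler_pM2l ?mulr_gt0 in o; lra.
pose Q := P - 'X; pose n := size Q.
pose s := [seq p + (q - p) / (i.+1)%:R | i <- iota 0 n].
have [Q0|QN0] := eqVneq Q 0.
  have := f_below; rewrite /f -[P](subrK 'X) -/Q Q0 add0r hornerX; lra.
suff : (size s < size Q)%N by rewrite size_map size_iota ltnn.
have qp0 : 0 < q - p by lra.
apply: max_poly_roots => //.
  apply/allP => _ /mapP[i _ ->]; rewrite /root !hornerE subr_eq0; apply/eqP; apply: id_on.
    by rewrite lerDl divr_ge0 ?ler0n // ltW.
  rewrite -lerBrDl; by rewrite ler_pdivrMr ?ltr0n // ler_peMr ?ler1n // ltW.
rewrite map_inj_uniq ?iota_uniq // => i j /addrI /(mulfI (lt0r_neq0 qp0)) /invr_inj /eqP.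
by rewrite eqr_nat => /eqP[].
Qed.

Lemma horner_cvg (Q : {poly R}) (u : nat -> R) l :
  u n @[n --> \oo] --> l -> Q.[u n] @[n --> \oo] --> Q.[l].
Proof.
move=> ul; elim/poly_ind: Q => [|Q c IH].
  by under eq_fun do rewrite horner0; rewrite horner0; exact: cvg_cst.
under eq_fun do rewrite hornerMXaddC; rewrite hornerMXaddC.
by apply: cvgD; [exact: cvgM|exact: cvg_cst].
Qed.

Lemma iter_limit_fixed u0 l : iter n f u0 @[n --> \oo] --> l -> f l = l.
Proof.
move=> ul; have fl := @horner_cvg P _ _ ul.
have ul' : iter n.+1 f u0 @[n --> \oo] --> l by rewrite (cvg_shiftS (fun n => iter n f u0)).
exact: (cvg_unique _ fl ul').
Qed.

Section Dynamics.
Variable ps : R.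
Hypothesis ps01 : 0 < ps < 1.
Hypothesis fps : f ps = ps.

Lemma f_le_below p : 0 <= p -> p <= ps -> f p <= p.
Proof.
move: ps01 => /andP[s0 s1] p0 ps'; have [->|pN0] := eqVneq p 0.
  by apply: le_trans (f_small _) _; rewrite ?expr0n ?mulr0 // lexx ler01.
have pp : 0 < p by rewrite lt_def pN0.
have := f_odds pp ps' s1; rewrite fps => o.
have {}o : (ps * (1 - ps)) * ((1 - p) * f p) <= (ps * (1 - ps)) * (p * (1 - f p)) by lra.
by rewrite ler_pM2l ?mulr_gt0 in o; lra.
Qed.

Lemma f_ge_above p : ps <= p -> p <= 1 -> p <= f p.
Proof.
move: ps01 => /andP[s0 s1] ps' p1; have [->|pN1] := eqVneq p 1.
  have := f_large (p := 1); rewrite subrr expr0n mulr0 => /(_ _); rewrite ler01 lexx => /(_ isT); lra.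
have pp : p < 1 by rewrite lt_neqAle pN1.
have := f_odds s0 ps' pp; rewrite fps => o.
have {}o : (ps * (1 - ps)) * (p * (1 - f p)) <= (ps * (1 - ps)) * ((1 - p) * f p) by lra.
by rewrite ler_pM2l ?mulr_gt0 in o; lra.
Qed.

(** Below [ps] the iterates decrease, and their limit is a fixed point less than
   [ps]. *)
Lemma iter_below p e : 0 <= p -> p < ps -> 0 < e -> exists k, iter k f p < e.
Proof.
move: (ps01) => /andP[s0 s1] p0 pps e0.
have inv k : 0 <= iter k f p <= p.
  elim: k => [|k /andP[i0 ip]] /=; first by rewrite p0 lexx.
  have /f01/andP[-> _] : 0 <= iter k f p <= 1 by apply/andP; split; lra.
  by apply: (le_trans _ ip); apply: f_le_below => //; lra.
have dec : {homo (fun k => iter k f p) : n m / (n <= m)%N >-> m <= n}.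
  apply/nonincreasing_seqP => k /=; have /andP[i0 ip] := inv k.
  by apply: f_le_below => //; lra.
have cv : cvgn (fun k => iter k f p).
  by apply: nonincreasing_is_cvgn => //; exists 0 => _ [k _ <-]; have /andP[] := inv k.
set l := limn _ in cv; have fl := iter_limit_fixed cv.
have l0 : 0 <= l by apply: limr_ge => //; near=> k; have /andP[] := inv k.
have lp : l <= p by apply: limr_le => //; near=> k; have /andP[] := inv k.
have l00 : l = 0.
  apply/eqP/negPn/negP => lN0; have lpos : 0 < l by rewrite lt_def lN0.
  exact: (fixed_point_unique lpos (le_lt_trans lp pps) s1 fl fps).
have [k _ /(_ k (leqnn k))] : \forall k \near \oo, iter k f p < e.
  by move/cvgr_lt : cv; apply; rewrite l00.
by exists k.
Unshelve. all: end_near. Qed.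

Lemma iter_above p e : ps < p -> p <= 1 -> 0 < e -> exists k, 1 - iter k f p < e.
Proof.
move: (ps01) => /andP[s0 s1] psp p1 e0.
have inv k : p <= iter k f p <= 1.
  elim: k => [|k /andP[ip i1]] /=; first by rewrite p1 lexx.
  have /f01/andP[_ ->] : 0 <= iter k f p <= 1 by apply/andP; split; lra.
  by rewrite andbT; apply: (le_trans ip); apply: f_ge_above => //; lra.
have inc : {homo (fun k => iter k f p) : n m / (n <= m)%N >-> n <= m}.
  apply/nondecreasing_seqP => k /=; have /andP[ip i1] := inv k.
  by apply: f_ge_above => //; lra.
have cv : cvgn (fun k => iter k f p).
  by apply: nondecreasing_is_cvgn => //; exists 1 => _ [k _ <-]; have /andP[] := inv k.
set l := limn _ in cv; have fl := iter_limit_fixed cv.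
have l1 : l <= 1 by apply: limr_le => //; near=> k; have /andP[] := inv k.
have lp : p <= l by apply: limr_ge => //; near=> k; have /andP[] := inv k.
have l11 : l = 1.
  apply/eqP/negPn/negP => lN1; have llt : l < 1 by rewrite lt_neqAle lN1.
  exact: (fixed_point_unique s0 (lt_le_trans psp lp) llt fps fl).
have [k _ /(_ k (leqnn k))] : \forall k \near \oo, 1 - e < iter k f p.
  by move/cvgr_gt : cv; apply; rewrite l11; lra.
by exists k; lra.
Unshelve. all: end_near. Qed.

End Dynamics.

End SShape.

(** * Uniform bounds on the hierarchical graphs *)

Section HierarchicalBounds.
Variables (R : realType) (G1 : ograph).
Hypothesis no_chord : ~~ oadj (osrc G1) (otgt G1).
Hypothesis two_paths : two_edge_disjoint_paths G1.

Let m : nat := #|{: oedge G1}|.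
Let f : R -> R := crossing_prob G1.
Let C : R := (m ^ 2)%:R.

Let m_gt0 : (0 < m)%N.
Proof.
have ts : otgt G1 != osrc G1 by rewrite eq_sym osrc_neq_otgt.
have [|g _] := edge_off ts; first by rewrite oadj_sym.
by apply/card_gt0P; exists g.
Qed.

Let C1 : 1 <= C.
Proof. by rewrite /C ler1n expn_gt0 m_gt0. Qed.

Let x01 (E : eqType) (p : R) : 0 <= p <= 1 -> forall e : E, 0 <= (fun=> p) e <= 1.
Proof. by []. Qed.

Let f01 p : 0 <= p <= 1 -> 0 <= f p <= 1.
Proof. by move=> p01; rewrite /f crossing_probE Pr_ge0 ?Pr_le1. Qed.

Let f_small p : 0 <= p <= 1 -> f p <= C * p ^+ 2.
Proof. exact: crossing_prob_small. Qed.

Let f_large p : 0 <= p <= 1 -> 1 - f p <= C * (1 - p) ^+ 2.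
Proof. exact: crossing_prob_large. Qed.

Let f_odds p q : 0 < p -> p <= q -> q < 1 ->
  q * (1 - p) * (f p * (1 - f q)) <= p * (1 - q) * (f q * (1 - f p)).
Proof. by rewrite /f !crossing_probE; apply: Pr_odds; exact: increasing_crosses. Qed.

Let f_poly : exists P : {poly R}, f = fun p => P.[p].
Proof.
have [P HP] := Ex_poly (enum {: oedge G1}) (fun w => (crosses w)%:R : R).
by exists P; apply/funext => p; rewrite /f crossing_probE /Pr HP.
Qed.

Lemma pstar_exists : exists p : R, 0 < p < 1 /\ crossing_prob G1 p = p.
Proof.
have [P fP] := f_poly; move: f01 f_small f_large f_odds; rewrite -/f fP => a b c d.
exact: (fixed_point_exists C1 b c).
Qed.

Lemma pstar_unique (p q : R) : 0 < p < 1 -> 0 < q < 1 ->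
  crossing_prob G1 p = p -> crossing_prob G1 q = q -> p = q.
Proof.
have [P fP] := f_poly; move: f01 f_small f_large f_odds; rewrite -/f fP => a b c d.
move=> /andP[p0 p1] /andP[q0 q1] fp fq; case: (ltgtP p q) => // pq.
  by case: (fixed_point_unique C1 b d p0 pq q1 fp fq).
by case: (fixed_point_unique C1 b d q0 pq p1 fq fp).
Qed.

Lemma iter_crossing_small (ps p e : R) : 0 < ps < 1 -> crossing_prob G1 ps = ps ->
  0 <= p -> p < ps -> 0 < e -> exists k, iter k f p < e.
Proof.
have [P fP] := f_poly; move: f01 f_small f_large f_odds; rewrite -/f fP => a b c d.
by move=> h1 h2; exact: (iter_below C1 a b d h1 h2).
Qed.

Lemma iter_crossing_large (ps p e : R) : 0 < ps < 1 -> crossing_prob G1 ps = ps ->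
  ps < p -> p <= 1 -> 0 < e -> exists k, 1 - iter k f p < e.
Proof.
have [P fP] := f_poly; move: f01 f_small f_large f_odds; rewrite -/f fP => a b c d.
by move=> h1 h2; exact: (iter_above C1 a b c d h1 h2).
Qed.

Let card_hier n : #|{: oedge (hier G1 n.+1)}| = (#|{: oedge (hier G1 n)}| * m)%N.
Proof. exact: card_oedge_replace. Qed.

Lemma card_hier_gt0 n : (0 < #|{: oedge (hier G1 n)}|)%N.
Proof.
elim: n => [|n IH]; last by rewrite card_hier muln_gt0 IH m_gt0.
by apply/card_gt0P; exists single_arc_root.
Qed.

Lemma hier_potential n : exists phi : overt (hier G1 n) -> nat, potential phi (2 ^ n).
Proof.
elim: n => [|n [phi pot]]; last by rewrite expnS; exact: potential_replace no_chord pot.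
by exists (fun b : bool => nat_of_bool b); split => // -[] [].
Qed.

Lemma bernoulli_ineq (x : R) k : 0 <= x <= 1 -> 1 - k%:R * x <= (1 - x) ^+ k.
Proof.
move=> /andP[x0 x1]; elim: k => [|k IH]; first by rewrite expr0 mul0r subr0.
rewrite exprS; apply: le_trans (_ : (1 - x) * (1 - k%:R * x) <= _); last first.
  by rewrite ler_wpM2l // subr_ge0.
have : 0 <= k%:R * (x * x) by rewrite !mulr_ge0 // ler0n.
by rewrite -[in X in _ -> X]natr1; lra.
Qed.

(* For [1 - p <= e0] one has [1 - f p <= (1 - p) / 2], and the bound of [near_one] is
   at least [1 / 2]. *)
Let e0 : R := (2 * C + 4 * m%:R)^-1.

Let e0P : [/\ 0 < e0, C * e0 <= 1 / 2 & m%:R * e0 <= 1 / 4].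
Proof.
have m1 : 1 <= m%:R :> R by rewrite ler1n.
have h := C1; have pos : 0 < 2 * C + 4 * m%:R by lra.
have e00 : 0 < e0 by rewrite invr_gt0.
have := mulVf (lt0r_neq0 pos); rewrite -/e0 => e1.
have : 0 <= e0 * C by rewrite mulr_ge0 // ltW //; lra.
have : 0 <= e0 * m%:R by rewrite mulr_ge0 // ltW.
by split => //; lra.
Qed.

(* Refining the graph costs the factor [p ^+ m], at least [1 - m * (1 - p)], while the
   defect of the coarser graph is quadratically smaller: the linear bound
   reproduces itself. *)
Let near_one p : 0 <= p <= 1 -> 1 - p <= e0 ->
  forall n (e : oedge (hier G1 n)), 1 - 2 * m%:R * (1 - p) <=
    Pr (fun=> p) (enum {: oedge (hier G1 n)}) (joins e).
Proof.
have [e00 Ce me] := e0P; have m1 : 1 <= m%:R :> R by rewrite ler1n.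
move=> + + n; elim: n p => [|n IH] p p01 pe e.
  have /andP[p0 p1] := p01.
  apply: le_trans (_ : Pr (fun=> p) (enum {: oedge (hier G1 0)}) (fun w => w e && true) <= _).
    rewrite Pr_and_true ?mem_enum // /Pr Ex_const mulr1.
    have : 0 <= (m%:R - 1) * (1 - p) by rewrite mulr_ge0 //; lra.
    lra.
  apply: Pr_le; first exact: x01.
  move=> w /andP[we _]; have := linked_edge we; rewrite /joins we /=.
  by case: e we => -[[] []] //= ae _ ->; rewrite linked_refl.
case: (mkedge_surj e) => -[e' g] ->; have /andP[p0 p1] := p01.
apply: le_trans (Pr_joins_replace e' g p01).
have fl := f_large p01; have ff := f01 p01.
have q0 : 0 <= 1 - p by lra.
have Cq : C * (1 - p) ^+ 2 <= (1 - p) / 2.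
  rewrite expr2 mulrA [_ / 2]mulrC ler_wpM2r //.
  have : C * (1 - p) <= C * e0 by rewrite ler_wpM2l //; have := C1; lra.
  lra.
have fe : 1 - f p <= e0 by lra.
have rho := IH _ ff fe e'.
have pm := @bernoulli_ineq (1 - p) m _.
have {}pm : 1 - m%:R * (1 - p) <= p ^+ m.
  by move: pm; rewrite subKr; apply; lra.
have mq : m%:R * (1 - p) <= 1 / 4.
  by apply: le_trans me; rewrite ler_wpM2l // ler0n.
have mf : m%:R * (1 - f p) <= m%:R * (1 - p) / 2.
  rewrite -mulrA ler_wpM2l ?ler0n //; lra.
have mf0 : 0 <= m%:R * (1 - f p) by rewrite mulr_ge0 ?ler0n //; lra.
apply: le_trans (_ : (1 - m%:R * (1 - p)) * (1 - 2 * m%:R * (1 - f p)) <= _).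
  have : 0 <= (m%:R * (1 - p)) * (2 * (m%:R * (1 - f p))) by rewrite !mulr_ge0 //; lra.
  lra.
apply: le_trans (_ : p ^+ m * (1 - 2 * m%:R * (1 - f p)) <= _).
  by rewrite ler_wpM2r //; lra.
by rewrite ler_wpM2l // exprn_ge0.
Qed.

(** After finitely many renormalizations the parameter is so close to 1 that
   [near_one] applies; each of them costs a positive factor. *)
Lemma joins_lower_bound (ps p : R) : 0 < ps < 1 -> crossing_prob G1 ps = ps ->
  ps < p -> p <= 1 -> exists2 c, 0 < c & exists N, forall n, (N <= n)%N ->
    forall e : oedge (hier G1 n), c <= Pr (fun=> p) (enum {: oedge (hier G1 n)}) (joins e).
Proof.
move=> ps01 fps psp p1; have [e00 Ce me] := e0P.
have p0 : 0 < p by case/andP: ps01 => s0 _; exact: lt_trans psp.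
have [K HK] := iter_crossing_large ps01 fps psp p1 e00.
have p01 : 0 <= p <= 1 by rewrite p1 ltW.
suff : exists2 c, 0 < c & forall n, (K <= n)%N ->
    forall e : oedge (hier G1 n), c <= Pr (fun=> p) (enum {: oedge (hier G1 n)}) (joins e).
  by case=> c c0 Hc; exists c => //; exists K.
have fpos q : ps < q -> q <= 1 -> ps < f q /\ f q <= 1.
  move=> psq q1; have q01 : 0 <= q <= 1 by rewrite q1 andbT ltW // (lt_trans _ psq) //; case/andP: ps01.
  split; last by case/andP: (f01 q01).
  have [P fP] := f_poly; move: f01 f_small f_large f_odds; rewrite -/f fP => a b c d.
  apply: (lt_le_trans psq); apply: (f_ge_above c d ps01) => //; first by have := congr1 (fun g => g ps) fP => /= <-.
  exact: ltW.
elim: K p psp p1 p0 p01 HK => [|K IH] p psp p1 p0 p01 HK.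
  exists (1 / 2); first lra.
  move=> n _ e; apply: le_trans (near_one p01 (ltW HK) e); rewrite /= in HK.
  have : m%:R * (1 - p) <= m%:R * e0 by rewrite ler_wpM2l ?ler0n // ltW.
  lra.
have [psf f1] := fpos p psp p1.
have f0 : 0 < f p by case/andP: ps01 => s0 _; exact: lt_trans psf.
have [|c c0 Hc] := IH (f p) psf f1 f0 (f01 p01); first by rewrite -iterSr.
exists (p ^+ m * c); first by rewrite mulr_gt0 // exprn_gt0.
case=> // n Kn e; case: (mkedge_surj e) => -[e' g] ->.
apply: le_trans (Pr_joins_replace e' g p01).
by rewrite ler_wpM2l ?exprn_ge0 ?(ltW p0) //; exact: Hc.
Qed.

Let D : nat := #|overt G1|.
(* Escaping to radius [rad k r] in the graph refined [k] times implies escaping to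
   radius [r] in the coarse one. *)
Let rad k r := iter k (fun r => (D * (r + 2))%N) r.

Let escape_sum n (p : R) r : R :=
  \sum_(e : oedge (hier G1 n)) Pr (fun=> p) (enum {: oedge (hier G1 n)}) (escapes e r).

Let escape_sum_step n p r : 0 <= p <= 1 ->
  escape_sum n.+1 p (D * (r + 2)) <= m%:R * escape_sum n (f p) r.
Proof.
move=> p01; rewrite /escape_sum.
rewrite (reindex (@mkedge (hier G1 n) G1)) /=; last first.
  by exists (@unmk (hier G1 n) G1) => i _; [exact: mkedgeK|exact: unmkK].
rewrite -(pair_bigA _ (fun e g => Pr (fun=> p) (enum {: oedge (hier G1 n.+1)})
  (@escapes (hier G1 n.+1) (mkedge (e, g)) (D * (r + 2))))) /= mulr_sumr.
apply: ler_sum => e _; rewrite mulr_natl -sumr_const; apply: ler_sum => g _.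
apply: le_trans (Pr_le (x01 p01) _ (fun w => @escapes_replace _ _ e g r w)) _.
by rewrite (Pr_replace (fun=> p) (fun=> @crosses G1)) /f crossing_probE.
Qed.

Let escape_sum_iter k n p r : 0 <= p <= 1 ->
  escape_sum (k + n) p (rad k r) <= m%:R ^+ k * escape_sum n (iter k f p) r.
Proof.
elim: k p => [|k IH] p p01; first by rewrite mul1r.
apply: le_trans (escape_sum_step _ _ p01) _.
by rewrite exprS -mulrA ler_wpM2l ?ler0n // iterSr; exact: IH (f01 p01).
Qed.

(* Roots of degree above [M] are few; the others have at most [2 * M] edges at their
   endpoints. *)
Let escape_sum0 n q M : 0 <= q <= 1 ->
  escape_sum n q 0 <= (high (hier G1 n) M)%:R + #|{: oedge (hier G1 n)}|%:R * (q * (2 * M)%:R).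
Proof.
move=> q01; have /andP[q0 q1] := q01.
rewrite /high natrD; set G := hier G1 n.
pose b1 (e : oedge G) := (M < deg (val e).1)%N; pose b2 (e : oedge G) := (M < deg (val e).2)%N.
have cE (b : oedge G -> bool) : #|[set e | b e]%SET|%:R = \sum_(e : oedge G) (b e)%:R :> R.
  by rewrite -sum1_card natr_sum big_mkcond /=; apply: eq_bigr => e _; rewrite inE; case: (b e).
rewrite (cE b1) (cE b2) -[X in X%:R * (q * _)](sum1_card) natr_sum mulr_suml -!big_split /=.
apply: ler_sum => e _; rewrite mul1r.
have q2 : 0 <= q * (2 * M)%:R by rewrite mulr_ge0 ?ler0n.
have l1 := Pr_le1 (x01 q01) (enum {: oedge G}) (escapes e 0).
rewrite /b1 /b2; case: (ltnP M _) => h1 /=; first by have := ler0n R (M < deg (val e).2)%N; rewrite mulr1n; lra.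
case: (ltnP M _) => h2 /=; first by rewrite mulr0n mulr1n; lra.
rewrite !add0r; apply: le_trans (Pr_escapes0 e q01) _.
by rewrite ler_wpM2l // ler_nat mul2n -addnn leq_add.
Qed.

Let high_hier L n : (high (hier G1 (L + n)) (m ^ L) <= m.-1 ^ L * (2 * #|{: oedge (hier G1 n)}|))%N.
Proof.
elim: L => [|L IH]; first by rewrite mul1n; exact: high_le.
rewrite !expnS -mulnA [(m * _)%N]mulnC.
apply: leq_trans (@high_replace (hier G1 (L + n)) G1 no_chord (m ^ L) _) _.
  by rewrite expn_gt0 m_gt0.
by rewrite leq_mul2l IH orbT.
Qed.

Let card_hierD k n : #|{: oedge (hier G1 (k + n))}| = (m ^ k * #|{: oedge (hier G1 n)}|)%N.
Proof. by elim: k => [|k IH]; [rewrite mul1n|rewrite addSn card_hier IH expnS mulnC mulnA]. Qed.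

(** First [L] is chosen so that endpoints of degree above [m ^ L] are rare, then [k]
   so that an edge at an endpoint of degree at most [m ^ L] is unlikely to be open
   after [k] renormalizations. *)
Lemma escapes_upper_bound (ps p dlt : R) : 0 < ps < 1 -> crossing_prob G1 ps = ps ->
  0 <= p -> p < ps -> 0 < dlt -> exists r N, forall n, (N <= n)%N ->
    (\sum_(e : oedge (hier G1 n)) Pr (fun=> p) (enum {: oedge (hier G1 n)}) (escapes e r)) /
    #|{: oedge (hier G1 n)}|%:R <= dlt.
Proof.
move=> ps01 fps p0 pps d0; have /andP[s0 s1] := ps01.
have p01 : 0 <= p <= 1 by rewrite p0 ltW // (lt_trans pps).
have mR : 0 < m%:R :> R by rewrite ltr0n.
pose x : R := m.-1%:R / m%:R.
have x1 : `|x| < 1.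
  rewrite ger0_norm ?divr_ge0 ?ler0n // ltr_pdivrMr // mul1r ltr_nat.
  by rewrite prednK.
have [L HL] : exists L, x ^+ L < dlt / 4.
  have /cvgr_lt/(_ (dlt / 4)) : x ^+ n @[n --> \oo] --> (0 : R) by exact: cvg_expr.
  have -> : 0 < dlt / 4 by lra.
  by move=> /(_ isT)[L _ /(_ L (leqnn L))]; exists L.
have K0 : 0 < dlt / (4 * (m ^ L)%:R) by rewrite divr_gt0 // mulr_gt0 // ltr0n expn_gt0 m_gt0.
have [k Hk] := iter_crossing_small ps01 fps p0 pps K0.
have q01 : 0 <= iter k f p <= 1 by elim: (k) => //= j IH; exact: f01.
set q := iter k f p in Hk q01.
exists (rad k 0), (k + L)%N => n; move/subnK; rewrite addnC -addnA => <-.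
set n' := (n - _)%N.
have := escape_sum_iter k (L + n') 0 p01; rewrite -/q /escape_sum => h.
rewrite ler_pdivrMr ?ltr0n ?card_hier_gt0 //; apply: le_trans h _.
rewrite [X in _ <= _ * X%:R]card_hierD natrM natrX mulrCA ler_wpM2l ?exprn_ge0 ?ler0n //.
apply: le_trans (escape_sum0 (L + n') (m ^ L) q01) _.
set N' := #|{: oedge (hier G1 (L + n'))}|.
have N'E : N'%:R = m%:R ^+ L * #|{: oedge (hier G1 n')}|%:R :> R.
  by rewrite /N' card_hierD natrM natrX.
have hi : (high (hier G1 (L + n')) (m ^ L))%:R <= dlt / 2 * N'%:R.
  apply: le_trans (_ : (m.-1 ^ L * (2 * #|{: oedge (hier G1 n')}|))%:R <= _).
    by rewrite ler_nat; exact: high_hier.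
  have -> : (m.-1 ^ L * (2 * #|{: oedge (hier G1 n')}|))%:R = 2 * x ^+ L * N'%:R.
    rewrite N'E !natrM natrX /x expr_div_n.
    have mL : m%:R ^+ L != 0 :> R by rewrite expf_neq0 // lt0r_neq0.
    have gen (a b E : R) : b != 0 -> a * (2 * E) = 2 * (a / b) * (b * E).
      move=> b0; have -> : 2 * (a / b) * (b * E) = 2 * a * E * (b^-1 * b) by lra.
      rewrite mulVf //; lra.
    exact: gen.
  rewrite ler_wpM2r ?ler0n //; lra.
have lo : q * (2 * m ^ L)%:R <= dlt / 2.
  have mLpos : 0 < (m ^ L)%:R :> R by rewrite ltr0n expn_gt0 m_gt0.
  have : q * (4 * (m ^ L)%:R) < dlt by rewrite -ltr_pdivlMr // mulr_gt0.
  rewrite natrM; lra.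
have : N'%:R * (q * (2 * m ^ L)%:R) <= N'%:R * (dlt / 2) by rewrite ler_wpM2l ?ler0n.
lra.
Qed.

End HierarchicalBounds.

(** * Escape probabilities in rooted graphs *)

Section LocalEscape.

Definition swapped_or_eq (T : Type) (p q : T * T) : Prop := p = q \/ p = (q.2, q.1).

(** An unoriented edge is listed once, so its two orientations name the same one. *)
Lemma redge_inj (g : rgraph) (e e' : redge g) : swapped_or_eq (val e) (val e') -> e = e'.
Proof.
have /andP[l1 _] := valP e; have /andP[l2 _] := valP e'.
case=> ee; first exact: val_inj.
by move: l1; rewrite ee /= ltnNge ltnW.
Qed.

Lemma redge_of (g : rgraph) x y : radj g x y ->
  exists e : redge g, swapped_or_eq (val e) (x, y).
Proof.
move=> xy; case: (ltngtP x y) => xly; last by rewrite xly radj_irr in xy.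
- have h : (x < y)%N && radj g x y by rewrite xly.
  by exists (exist _ (x, y) h); left.
- have h : (y < x)%N && radj g y x by rewrite xly radj_sym.
  by exists (exist _ (y, x) h); right.
Qed.

Lemma open_radjP (g : rgraph) (w : config (redge g)) x y :
  reflect (exists2 e : redge g, w e & swapped_or_eq (val e) (x, y)) (open_radj w x y).
Proof. by apply: (iffP (asboolP _)) => [[e [we ve]]|[e we ve]]; exists e. Qed.

Lemma open_radj_radj (g : rgraph) (w : config (redge g)) x y : open_radj w x y -> radj g x y.
Proof.
move=> /open_radjP[e _ ve]; have /andP[_ ae] := valP e.
by case: ve ae => -> //=; rewrite radj_sym.
Qed.

Definition root_end (g : rgraph) (s : nat) : Prop := s = (rroot g).1 \/ s = (rroot g).2.

(** The finite-volume version of [root_to_infinity], see [root_to_infinityE]. *)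
Definition rescapes (g : rgraph) (r : nat) (w : config (redge g)) : bool :=
  `[< exists s y, [/\ root_end g s, open_cluster w s y & ~ rball g r y] >].

Lemma open_cluster_step (g : rgraph) (w : config (redge g)) s x y :
  open_cluster w s x -> open_radj w x y -> open_cluster w s y.
Proof.
move=> [p /andP[pp /eqP lx]] xy; exists (rcons p y).
by rewrite /walk rcons_path last_rcons pp lx xy eqxx.
Qed.

Arguments rescapes : clear implicits.

(** A cluster leaving the ball of radius [r] does so by open edges of the ball of
   radius [r + 1], so only this ball matters. *)
Lemma rescapes_map (g h : rgraph) r (f : nat -> nat) (w : config (redge g)) (w' : config (redge h)) :
  (forall s, root_end g s -> root_end h (f s)) ->
  (forall x, rball g r.+1 x -> ~ rball g r x -> ~ rball h r (f x)) ->
  (forall x y, rball g r.+1 x -> rball g r.+1 y -> open_radj w x y ->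
     open_radj w' (f x) (f y)) ->
  rescapes g r w -> rescapes h r w'.
Proof.
move=> fr fout fopen /asboolP[s [y [sr [p /andP[pp /eqP ly]] yr]]].
apply/asboolP; exists (f s).
have sc : open_cluster w' (f s) (f s) by exists [::]; rewrite /walk /= eqxx.
have sb : rball g r s.
  by have [r1 r2] := rball_root g r; case: sr => ->.
suff main x : rball g r x -> open_cluster w' (f s) (f x) -> path (open_radj w) x p ->
    last x p = y -> exists z, [/\ root_end h (f s), open_cluster w' (f s) z & ~ rball h r z].
  exact: main pp ly.
elim: p x {pp ly} => [|z p IH] x xr xc /=; first by move=> _ xy; rewrite -xy in yr.
move=> /andP[xz pp] ly.
have zr : rball g r.+1 z by apply: rball_adj xr _; exact: open_radj_radj xz.
have zc : open_cluster w' (f s) (f z).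
  by apply: open_cluster_step xc _; apply: fopen => //; exact: rball_le xr.
have [zb|zb] := pselect (rball g r z); first exact: IH zb zc pp ly.
by exists (f z); split; [exact: fr| |exact: fout].
Qed.

Lemma ball_edges (g : rgraph) r : exists2 s : seq (redge g), uniq s &
  forall e, e \in s <-> rball g r (val e).1 /\ rball g r (val e).2.
Proof.
have /finite_seqP[l lE] := rball_finite g r.
exists (undup (pmap insub [seq (x, y) | x <- l, y <- l])); first exact: undup_uniq.
move=> e; have inl x : (x \in l) <-> rball g r x by rewrite lE.
rewrite mem_undup mem_pmap_sub; split.
  by case/allpairsP => -[x y] [/= /inl xl /inl yl ->].
move=> [/inl x1 /inl x2]; apply/allpairsP; exists (val e) => //=.
by split => //; case: (val e).
Qed.

Lemma depends_rescapes (g : rgraph) r (s : seq (redge g)) :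
  (forall e, rball g r.+1 (val e).1 -> rball g r.+1 (val e).2 -> e \in s) ->
  depends s (rescapes g r).
Proof.
move=> sall; have main (w w' : config (redge g)) : {in s, forall e, w e = w' e} ->
    rescapes g r w -> rescapes g r w'.
  move=> ww; apply: (@rescapes_map g g r id) => // x y xr yr /open_radjP[e we ve].
  apply/open_radjP; exists e => //; rewrite -ww //.
  by apply: sall; case: ve => -> /=.
by move=> w w' ww; apply/idP/idP; apply: main => // e es; rewrite ww.
Qed.

Variable R : realType.

Definition theta_ball (g : rgraph) (r : nat) (p : R) : R :=
  fine (percolation g p [set w | rescapes g r w]).

Lemma theta_ballE (g : rgraph) r (p : R) (s : seq (redge g)) : 0 <= p <= 1 -> uniq s ->
  (forall e, rball g r.+1 (val e).1 -> rball g r.+1 (val e).2 -> e \in s) ->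
  percolation g p [set w | rescapes g r w] = (theta_ball g r p)%:E /\
  theta_ball g r p = Pr (fun=> p) s (rescapes g r).
Proof.
move=> p01 us sall; rewrite /theta_ball.
by rewrite (bernoulli_Pr (@percolationP R g p p01) us (depends_rescapes sall)).
Qed.

Lemma theta_ball_fin (g : rgraph) r (p : R) : 0 <= p <= 1 ->
  percolation g p [set w | rescapes g r w] = (theta_ball g r p)%:E.
Proof.
move=> p01; have [s us sP] := ball_edges g r.+1.
by have [] := theta_ballE p01 us (fun e h1 h2 => (sP e).2 (conj h1 h2)).
Qed.

Lemma theta_ball01 (g : rgraph) r (p : R) : 0 <= p <= 1 -> 0 <= theta_ball g r p <= 1.
Proof.
move=> p01; have [s us sP] := ball_edges g r.+1.
have [_ ->] := theta_ballE p01 us (fun e h1 h2 => (sP e).2 (conj h1 h2)).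
by rewrite Pr_ge0 ?Pr_le1.
Qed.

(** By [rescapes_map], applied to an isomorphism of balls and to its inverse, the
   escape events correspond once the edges of the two balls are matched. *)
Lemma theta_ball_iso (g h : rgraph) r (p : R) : 0 <= p <= 1 -> riso_ball r.+1 g h ->
  theta_ball g r p = theta_ball h r p.
Proof.
move=> p01 [f [fb fadj froot]]; have [fAB finj _] := fb.
have [g1 g2] := rball_root g r.+1.
have [f' [[f'BA f'inj _] f'adj f'root [f'K fK]]] := riso_on_inv g1 g2 fb fadj froot.
have [s us sP] := ball_edges g r.+1.
have [e0 _] := redge_of (rroot_adj h).
pose img (e : redge g) : set (redge h) :=
  [set e' | swapped_or_eq (val e') (f (val e).1, f (val e).2)].
pose phi e := xget e0 (img e).
have phiP e : e \in s -> swapped_or_eq (val (phi e)) (f (val e).1, f (val e).2).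
  move=> /sP[b1 b2]; rewrite /phi; case: xgetP => [e' _ //|].
  have /andP[_ ae] := valP e.
  have [e' e'P] : exists e' : redge h, swapped_or_eq (val e') (f (val e).1, f (val e).2).
    by apply: redge_of; rewrite fadj.
  by move/(_ e').
have f_inj x y : f x = f y -> rball g r.+1 x -> rball g r.+1 y -> x = y.
  by move=> fxy xb yb; apply: finj fxy; rewrite inE.
have phi_surj (e' : redge h) : rball h r.+1 (val e').1 -> rball h r.+1 (val e').2 ->
    exists2 e, e \in s & phi e = e' /\ swapped_or_eq (val e) (f' (val e').1, f' (val e').2).
  move=> b1 b2; have /andP[_ ae'] := valP e'.
  have [e eP] : exists e : redge g, swapped_or_eq (val e) (f' (val e').1, f' (val e').2).
    by apply: redge_of; rewrite f'adj.
  have es : e \in s by apply/sP; case: eP => -> /=; split; exact: f'BA.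
  exists e => //; split => //; apply: redge_inj; have := phiP e es.
  by rewrite /swapped_or_eq; case: eP => -> /=; rewrite !fK // -surjective_pairing => -[]; tauto.
have phi_inj : {in s &, injective phi}.
  move=> e1 e2 s1 s2 pe; apply: redge_inj; move: (s1) (s2) => /sP[a1 a2] /sP[b1 b2].
  have := phiP e1 s1; have := phiP e2 s2; rewrite -pe.
  rewrite /swapped_or_eq (surjective_pairing (val e1)) (surjective_pairing (val e2)) /=.
  move=> [] -> [] [] /f_inj h1 /f_inj h2.
  - by left; rewrite (h1 b1 a1) (h2 b2 a2).
  - by right; rewrite (h1 b1 a2) (h2 b2 a1).
  - by right; rewrite (h1 b2 a1) (h2 b1 a2).
  - by left; rewrite (h1 b2 a2) (h2 b1 a1).
have [_ ->] := theta_ballE p01 us (fun e h1 h2 => (sP e).2 (conj h1 h2)).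
have upm : uniq (map phi s) by rewrite map_inj_in_uniq.
have [_ ->] : percolation h p [set w | rescapes h r w] = (theta_ball h r p)%:E /\
    theta_ball h r p = Pr (fun=> p) (map phi s) (rescapes h r).
  apply: theta_ballE => // e' b1 b2; have [e es [<- _]] := phi_surj e' b1 b2.
  exact: map_f.
apply: Ex_transport => // w w' ww; congr (nat_of_bool _)%:R.
have out k l F F' : set_bij (rball k r.+1) (rball l r.+1) F ->
    (forall x, rball k r.+1 x -> F' (F x) = x) ->
    set_fun (rball l r.+1) (rball k r.+1) F' ->
    (forall x y, rball l r.+1 x -> rball l r.+1 y -> radj k (F' x) (F' y) = radj l x y) ->
    (F' (rroot l).1, F' (rroot l).2) = rroot k \/ (F' (rroot l).2, F' (rroot l).1) = rroot k ->
    forall x, rball k r.+1 x -> ~ rball k r x -> ~ rball l r (F x).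
  move=> Fb F'K F'fun F'adj F'root x xb nx Fx; apply: nx.
  rewrite -(F'K x xb); exact: (riso_ball_homo (leqnSn r) F'fun F'adj F'root).
apply/idP/idP.
- apply: (rescapes_map (f := f)).
  + by move=> i [->|->]; rewrite /root_end; case: froot => <-; [left|right|right|left].
  + exact: out fb f'K f'BA f'adj f'root.
  + move=> x y xb yb /open_radjP[e we ve]; apply/open_radjP.
    have es : e \in s by apply/sP; case: ve => ->.
    exists (phi e); first by rewrite -ww.
    by have := phiP e es; rewrite /swapped_or_eq; case: ve => -> /=; tauto.
- apply: (rescapes_map (f := f')).
  + by move=> i [->|->]; rewrite /root_end; case: f'root => <-; [left|right|right|left].
  + have f'b : set_bij (rball h r.+1) (rball g r.+1) f'.
      split => // x xb; exists (f x); [exact: fAB|exact: f'K].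
    exact: (out _ _ f' f f'b fK fAB fadj froot).
  + move=> x y xb yb /open_radjP[e' we ve]; apply/open_radjP.
    have [|| e es [pe eP]] := phi_surj e'; [by case: ve => ->..|].
    exists e; first by rewrite ww // pe.
    by move: eP; rewrite /swapped_or_eq; case: ve => -> /=; tauto.
Qed.

End LocalEscape.
Arguments rescapes : clear implicits.

Section RootedFiniteGraph.
Variables (R : realType) (G : ograph) (e : oedge G).

Let num (x : overt G) : nat := enum_rank x.

Let num_inj : injective num.
Proof. by move=> x y /ord_inj/enum_rank_inj. Qed.

Lemma walk_num (a : rel (overt G)) (b : rel nat) (x : overt G) y p :
  (forall u v, b (num u) (num v) = a u v) ->
  (forall u y, b (num u) y -> exists v, y = num v) ->
  walk b (num x) y p -> exists v q, [/\ y = num v, size q = size p & walk a x v q].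
Proof.
move=> ab bnum /andP[pp /eqP <-]; elim: p x pp => [|z p IH] x /=.
  by move=> _; exists x, [::]; rewrite /walk /= eqxx.
move=> /andP[xz]; have [v zv] := bnum _ _ xz; rewrite zv in xz *.
move=> /IH[u [q [lu sq wq]]]; exists u, (v :: q); split => //=; first by rewrite sq.
by move: wq; rewrite /walk /= -ab xz.
Qed.

Lemma num_walk (a : rel (overt G)) (b : rel nat) (x y : overt G) p :
  (forall u v, b (num u) (num v) = a u v) ->
  walk a x y p -> walk b (num x) (num y) (map num p).
Proof.
move=> ab /andP[pp /eqP <-]; rewrite /walk last_map eqxx andbT.
by elim: p x pp => //= z p IH x /andP[xz /IH ->]; rewrite ab xz.
Qed.

Let fin_num u v : @fin_adj G (num u) (num v) = oadj u v.
Proof.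
apply/fin_adjP/idP => [[x [y [xy /num_inj -> /num_inj ->]]] //|uv].
by exists u, v.
Qed.

Let fin_numE u y : @fin_adj G (num u) y -> exists v, y = num v.
Proof. by move=> /fin_adjP[x [v [_ _ ->]]]; exists v. Qed.

Lemma rball_rooted r v : rball (rooted e) r (num v) <-> edge_ball e r v.
Proof.
split=> [/rballP[s [p [sr wp sp]]]|].
  have [s' sE s'r] : exists2 s', s = num s' & s' = (val e).1 \/ s' = (val e).2.
    by case: sr => ->; [exists (val e).1|exists (val e).2] => //; [left|right].
  rewrite sE in wp; have [v' [q [/num_inj <- sq wq]]] := walk_num fin_num fin_numE wp.
  by case: s'r wq => -> wq; [left|right]; exists q; rewrite ?sq.
by case=> -[p wp sp]; apply: (@rball_walk (rooted e) r _ _ (map num p));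
  rewrite ?size_map //; [left|apply: num_walk fin_num wp|right|apply: num_walk fin_num wp].
Qed.

Let tag_ex (f : oedge G) : exists f' : redge (rooted e),
  swapped_or_eq (val f') (num (val f).1, num (val f).2).
Proof. by apply: redge_of; rewrite /= fin_num; apply/orP; left; exact: (valP f). Qed.

Let tag f : redge (rooted e) := sval (cid (tag_ex f)).

Let tagP f : swapped_or_eq (val (tag f)) (num (val f).1, num (val f).2).
Proof. exact: svalP (cid (tag_ex f)). Qed.

Let tag_inj : injective tag.
Proof.
move=> f f' ff; have := tagP f; rewrite ff; have := tagP f'.
have af := valP f; have af' := valP f'.
have same : (val f) = (val f') -> f = f' by exact: val_inj.
have swap : (val f) = ((val f').2, (val f').1) -> f = f'.
  by move=> q; have /negP := oarc_asym af; rewrite q.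
move: same swap; rewrite /swapped_or_eq (surjective_pairing (val f)) (surjective_pairing (val f')).
move=> same swap [] -> [] [] /num_inj h1 /num_inj h2; rewrite /= in h1 h2.
all: (try by apply: same; rewrite h1 h2); apply: swap; by rewrite h1 h2.
Qed.

Let tag_surj (f : redge (rooted e)) : exists f', f = tag f'.
Proof.
have /andP[_ /fin_adjP[x [y [xy fx fy]]]] := valP f.
have [f' f'P] : exists f' : oedge G, swapped_or_eq (val f') (x, y).
  by case/orP: xy => a; [exists (exist _ (x, y) a); left|exists (exist _ (y, x) a); right].
exists f'; apply: redge_inj; have := tagP f'.
rewrite /swapped_or_eq (surjective_pairing (val f)) fx fy.
by case: f'P => -> /= [] ->; tauto.
Qed.

(** Numbering the vertices changes neither balls nor clusters. *)
Lemma theta_ball_rooted r (p : R) : 0 <= p <= 1 ->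
  theta_ball (rooted e) r p = Pr (fun=> p) (enum {: oedge G}) (escapes e r).
Proof.
move=> p01.
have upm : uniq (map tag (enum {: oedge G})) by rewrite (map_inj_uniq tag_inj) enum_uniq.
have [_ ->] : percolation (rooted e) p [set w | rescapes (rooted e) r w] =
    (theta_ball (rooted e) r p)%:E /\ theta_ball (rooted e) r p =
    Pr (fun=> p) (map tag (enum {: oedge G})) (rescapes (rooted e) r).
  apply: theta_ballE => // f _ _; have [f' ->] := tag_surj f.
  by apply: map_f; rewrite mem_enum.
symmetry; apply: Ex_transport => // w w' ww; congr (nat_of_bool _)%:R.
have {}ww f : w f = w' (tag f) by apply: ww; rewrite mem_enum.
have open_num u v : open_radj w' (num u) (num v) = open_nbr w u v.
  apply/open_radjP/open_nbrP => [[f wf]|[f wf fuv]].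
    have [f' fE] := tag_surj f; rewrite fE in wf *; have := tagP f'.
    rewrite /swapped_or_eq => h1 h2; exists f'; first by rewrite ww.
    rewrite (surjective_pairing (val f')).
    by case: h1 h2 => -> [] [] /num_inj -> /num_inj ->; [left|right|right|left].
  exists (tag f); first by rewrite -ww.
  by have := tagP f; rewrite /swapped_or_eq; case: fuv => -> /=; tauto.
have open_numE u y : open_radj w' (num u) y -> exists v, y = num v.
  by move=> /open_radj_radj; exact: fin_numE.
apply/asboolP/asboolP.
- move=> [s [v [sr sv far]]].
  exists (num s), (num v); split.
  + by case: sr => ->; [left|right].
  + have /connectP[q pq lq] := sv; exists (map num q).
    by apply: (@num_walk (open_nbr w)) => //; rewrite /walk pq lq eqxx.
  + by move=> /rball_rooted.
- move=> [s [y [sr [q wq] far]]].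
  have [s' sE s'r] : exists2 s', s = num s' & s' = (val e).1 \/ s' = (val e).2.
    by case: sr => ->; [exists (val e).1|exists (val e).2] => //; [left|right].
  rewrite sE in wq; have [v [q' [yE _ /andP[pq /eqP lq]]]] := walk_num open_num open_numE wq.
  exists s', v; split => //; first by apply/connectP; exists q'.
  by move=> /rball_rooted; rewrite -yE.
Qed.

End RootedFiniteGraph.

Section InfiniteCluster.
Variables (R : realType) (g : rgraph).

(** Balls are finite, and a finite cluster is contained in some ball. *)
Lemma root_to_infinityE :
  @root_to_infinity g = \bigcap_r [set w | rescapes g r w].
Proof.
have vert (w : config (redge g)) s y : root_end g s -> open_cluster w s y -> rvert g y.
  move=> sr [p /andP[pp /eqP <-]]; have : rvert g s.
    by have [r1 r2] := rroot_vert g; case: sr => ->.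
  elim: p s {sr} pp => //= z p IH s /andP[/open_radj_radj sz pp] _; apply: IH pp _.
  by apply: (@radj_vert g _ s); rewrite radj_sym.
apply/seteqP; split => w.
  have main s : root_end g s -> infinite_set (open_cluster w s) -> forall r, rescapes g r w.
    move=> sr inf r; apply/asboolP/not_existsP => nesc; apply: inf.
    apply: sub_finite_set (rball_finite g r) => y sy.
    apply/not_notP => yr; apply: (nesc s); exists y; split => //.
  by case=> [inf|inf] r _; apply: main inf _; [left|right].
move=> esc; apply/not_notP => /not_orP[/contrapT f1 /contrapT f2].
have := f1; rewrite /= => /finite_seqP[l1 l1E]; have := f2 => /finite_seqP[l2 l2E].
pose r := (\max_(y <- l1 ++ l2) gdist (radj g) (rroot g).1 y)%N.
have /asboolP[s [y [sr sy]]] := esc r I; apply.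
split; first exact: vert sr sy.
left; have yl : y \in l1 ++ l2.
  rewrite mem_cat; case: sr sy => ->; rewrite ?l1E ?l2E /= => ->; by rewrite ?orbT.
by rewrite /r (big_rem y yl) /= leq_maxl.
Qed.

Lemma measurable_rescapes r : measurable [set w : config (redge g) | rescapes g r w].
Proof.
have [s us sP] := ball_edges g r.+1; apply: (@measurable_depends _ s).
by apply: depends_rescapes => e h1 h2; apply/sP.
Qed.

Lemma theta_le_ball r (p : R) : 0 <= p <= 1 -> (theta g p <= (theta_ball g r p)%:E)%E.
Proof.
move=> p01; rewrite /theta -theta_ball_fin // root_to_infinityE; apply: le_measure.
- by rewrite inE; apply: bigcapT_measurable => i; exact: measurable_rescapes.
- by rewrite inE; exact: measurable_rescapes.
- by move=> w /(_ r I).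
Qed.

Lemma theta_ge (p c : R) : 0 <= p <= 1 -> (forall r, c <= theta_ball g r p) ->
  (c%:E <= theta g p)%E.
Proof.
move=> p01 cr; rewrite /theta root_to_infinityE.
pose F r := [set w : config (redge g) | rescapes g r w].
have cv : percolation g p (F n) @[n --> \oo] --> percolation g p (\bigcap_n F n).
  apply: nonincreasing_cvg_mu.
  - by rewrite [X in (X < _)%E](theta_ball_fin g 0 p01) ltry.
  - by move=> n; exact: measurable_rescapes.
  - by apply: bigcapT_measurable => i; exact: measurable_rescapes.
  - apply/nonincreasing_seqP => n; rewrite subsetEset => w /asboolP[s [y [sr sy yr]]].
    by apply/asboolP; exists s, y; split => //; apply: contra_not yr; exact: rball_le.
rewrite -(cvg_lim _ cv) //; apply: lime_ge; first by apply/cvg_ex; eexists; exact: cv.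
by near=> n; rewrite theta_ball_fin // lee_fin.
Unshelve. all: end_near. Qed.

End InfiniteCluster.

(** * Passage to the limit *)

Section LocalFunctions.
Variable R : realType.

Lemma rball_map (g h : rgraph) r f : set_fun (rvert g) (rvert h) f ->
  (forall x y, rvert g x -> rvert g y -> radj h (f x) (f y) = radj g x y) ->
  (f (rroot g).1, f (rroot g).2) = rroot h \/ (f (rroot g).2, f (rroot g).1) = rroot h ->
  forall x, rball g r x -> rball h r (f x).
Proof.
move=> fV fadj froot x /rballP[s [p [sr /andP[pp /eqP <-] sp]]].
have vs : rvert g s by have [? ?] := rroot_vert g; case: sr => ->.
apply: (@rball_walk h r (f s) _ (map f p)); rewrite ?size_map //.
  by case: sr => ->; case: froot => <-; [left|right|right|left].
rewrite /walk last_map eqxx andbT; elim: p s vs pp {sr sp} => //= z p IH s vs /andP[sz pp].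
have vz : rvert g z by apply: (@radj_vert g _ s); rewrite radj_sym.
by rewrite fadj // sz IH.
Qed.

Lemma riso_riso_ball (g h : rgraph) r : riso g h -> riso_ball r g h.
Proof.
move=> /asboolP[f [fb fadj froot]]; have [fV finj _] := fb.
have [v1 v2] := rroot_vert g.
have [f' [[f'V _ _] f'adj f'root [f'K fK]]] := riso_on_inv v1 v2 fb fadj froot.
exists f; split => //; last by move=> x y /rball_vert xv /rball_vert yv; exact: fadj.
split.
- exact: rball_map.
- by move=> x y; rewrite !inE => /rball_vert xv /rball_vert yv; apply: finj; rewrite inE.
- move=> y yr; exists (f' y); last by apply: fK; exact: rball_vert yr.
  exact: rball_map f'V f'adj f'root _ yr.
Qed.

Definition local (T : Type) (r : nat) (F : rgraph -> T) : Prop :=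
  forall g h, riso_ball r g h -> F g = F h.

(** The ball of radius [1 / (r + 1)] around [x] consists of graphs that share with [x]
   a ball of radius more than [r] around the root. *)
Lemma local_near (T : Type) r (F : rgraph -> T) (x : rspace R) : local r F ->
  \forall y \near x, F (rrepr y) = F (rrepr x).
Proof.
move=> lF; apply/nbhs_ballP; exists r.+1%:R^-1 => /=; first by rewrite invr_gt0 ltr0n.
move=> y; rewrite ballEmdist /= => /rdist_lt[r' xy].
rewrite ltf_pV2 ?posrE ?ltr0n // ltr_nat ltnS => rr; symmetry; apply: lF.
exact: riso_ball_le (ltnW rr) xy.
Qed.

Lemma local_continuous r (F : rgraph -> R) : local r F ->
  continuous (fun x : rspace R => F (rrepr x)).
Proof. by move=> lF x; apply: cvg_near_cst; [exact: nbhs_filter|exact: local_near lF]. Qed.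

Lemma local_measurable r (P : rgraph -> Prop) : local r P ->
  measurable [set x : borel_rspace R | P (rrepr (x : rspace R))].
Proof.
move=> lP; apply: sub_sigma_algebra; rewrite openE => x Px.
rewrite /interior /=; have := local_near (x : rspace R) lP; apply: filterS => y /= ->.
exact: Px.
Qed.

Lemma local_comp (T U : Type) r (F : rgraph -> T) (phi : T -> U) :
  local r F -> local r (phi \o F).
Proof. by move=> lF g h /lF gh; rewrite /= gh. Qed.

Lemma local_measurable_fun r (F : rgraph -> R) : local r F ->
  measurable_fun setT (EFin \o (fun x : borel_rspace R => F (rrepr (x : rspace R)))).
Proof.
move=> lF _ B _; rewrite setTI.
exact: (local_measurable (local_comp (fun t : R => B t%:E) lF)).
Qed.

End LocalFunctions.

Section BSLimit.
Variables (R : realType) (G1 : ograph).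
Variable mu : probability (borel_rspace R) R.
Hypothesis no_chord : ~~ oadj (osrc G1) (otgt G1).
Hypothesis hmu : is_BS_limit G1 mu.

Let mean_local r (F : rgraph -> R) k : local r F ->
  hier_mean G1 (fun x : rspace R => F (rrepr x)) k =
  (\sum_(e : oedge (hier G1 k)) F (rooted e)) / #|{: oedge (hier G1 k)}|%:R.
Proof.
move=> lF; congr (_ / _); apply: eq_bigr => e _; apply: lF; apply: riso_riso_ball.
by apply/(rclass_eqP R); rewrite rreprK.
Qed.

Let mean_cvg r (F : rgraph -> R) : local r F -> (forall g, 0 <= F g <= 1) ->
  ((\sum_(e : oedge (hier G1 k)) F (rooted e)) / #|{: oedge (hier G1 k)}|%:R)%:E
    @[k --> \oo] --> (\int[mu]_x (F (rrepr (x : rspace R)))%:E)%E.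
Proof.
move=> lF F01; have := hmu (local_continuous lF).
move=> /(_ _)/wrap[].
  by exists 1 => x; have /andP[F0 F1] := F01 (rrepr x); rewrite ger0_norm.
by under eq_fun => k do rewrite (mean_local k lF).
Qed.

(** The indicator of a local property is continuous, and its averages are
   eventually 1. *)
Lemma BS_ae_local r (P : rgraph -> Prop) N : local r P ->
  (forall n, (N <= n)%N -> forall e : oedge (hier G1 n), P (rooted e)) ->
  {ae mu, forall x : borel_rspace R, P (rrepr (x : rspace R))}.
Proof.
move=> lP HP; pose F g : R := (`[< P g >])%:R.
have lF : local r F by exact: (local_comp (fun Q : Prop => (`[< Q >])%:R) lP).
have F01 g : 0 <= F g <= 1 by rewrite ler0n lern1 leq_b1.
have cv := mean_cvg lF F01.
pose A := [set x : borel_rspace R | P (rrepr (x : rspace R))].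
have mA : measurable A by exact: local_measurable lP.
have IA : (\int[mu]_x (F (rrepr (x : rspace R)))%:E)%E = mu A.
  rewrite -[in RHS](setIT A) -(integral_indic _ measurableT mA); apply: eq_integral => x _.
  congr (_%:E); rewrite /F indicE.
have A1 : mu A = 1%E.
  rewrite -IA; apply: (cvg_unique _ cv) => //; apply: cvg_near_cst.
  exists N => // n /= Nn; congr (_%:E).
  rewrite (eq_bigr (fun=> 1)) => [|e _]; last by rewrite /F asboolT //; exact: HP.
  rewrite sumr_const divff // pnatr_eq0 -lt0n; exact: (card_hier_gt0 no_chord).
apply/negligibleP; first exact: measurableC mA.
by have := probability_setC mu mA; rewrite A1 subee //; apply: etrans.
Qed.

(** Markov's inequality: the set where all the [F r] are at least [a] is contained
   in each set where one of them is, and these have arbitrarily small measure. *)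
Lemma BS_ae_small (F : nat -> rgraph -> R) (rho : nat -> nat) :
  (forall r, local (rho r) (F r)) -> (forall r g, 0 <= F r g <= 1) ->
  (forall d, 0 < d -> exists r N, forall n, (N <= n)%N ->
     (\sum_(e : oedge (hier G1 n)) F r (rooted e)) / #|{: oedge (hier G1 n)}|%:R <= d) ->
  forall a, 0 < a -> {ae mu, forall x : borel_rspace R,
    exists r, F r (rrepr (x : rspace R)) < a}.
Proof.
move=> lF F01 small a a0.
pose B r := [set x : borel_rspace R | a <= F r (rrepr (x : rspace R))].
have mB r : measurable (B r).
  exact: (local_measurable (local_comp (fun t : R => is_true (a <= t)) (lF r))).
have muB r d N : (forall n, (N <= n)%N ->
     (\sum_(e : oedge (hier G1 n)) F r (rooted e)) / #|{: oedge (hier G1 n)}|%:R <= d) ->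
     (a%:E * mu (B r) <= d%:E)%E.
  move=> Hd; have cv := mean_cvg (lF r) (F01 r).
  apply: le_trans (_ : \int[mu]_x (F r (rrepr (x : rspace R)))%:E <= _)%E; last first.
    rewrite -(cvg_lim _ cv) //; apply: lime_le; first by apply/cvg_ex; eexists; exact: cv.
    by exists N => // n /= Nn; rewrite lee_fin; exact: Hd.
  have := le_integral_abse mu measurableT (local_measurable_fun (lF r)) a0.
  have absE (x : borel_rspace R) : `|(EFin \o (fun x : borel_rspace R => F r (rrepr (x : rspace R)))) x|%E =
      (F r (rrepr (x : rspace R)))%:E.
    by rewrite /= ger0_norm //; case/andP: (F01 r (rrepr (x : rspace R))).
  rewrite setTI (_ : [set x | _] = B r); last first.
    by apply/seteqP; split => x; rewrite /B /mkset absE lee_fin.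
  by rewrite (eq_integral (fun x : borel_rspace R => (F r (rrepr (x : rspace R)))%:E)).
have mu0 : mu (\bigcap_r B r) = 0%E.
  apply/eqP; rewrite eq_le measure_ge0 andbT; apply/lee_addgt0Pr => d d0.
  have [|r [N Hd]] := small (a * d); first exact: mulr_gt0.
  rewrite add0e; apply: le_trans (_ : mu (B r) <= _)%E.
    apply: le_measure; rewrite ?inE //; first exact: bigcapT_measurable.
    by move=> x; apply.
  by have := muB _ _ _ Hd; rewrite EFinM lee_pmul2l.
apply: negligibleS (_ : mu.-negligible (\bigcap_r B r)).
  by move=> x /= /forallNP nx r _; rewrite /B /= leNgt; apply/negP; exact: nx.
apply/negligibleP => //; exact: bigcapT_measurable.
Qed.

End BSLimit.

(** Only a sequence of parameters tending to [ps] is tested from below, because only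
   countably many null sets can be discarded. *)
Lemma critical_prob_eq (R : realType) (g : rgraph) (ps : R) : 0 < ps < 1 ->
  (forall j, theta g (Num.max 0 (ps - j.+1%:R^-1)) = 0%E) ->
  (forall p, ps < p -> p <= 1 -> (0 < theta g p)%E) ->
  critical_prob R g = ps.
Proof.
move=> /andP[s0 s1] below above; rewrite /critical_prob; set S := [set p | _].
have Sub p : S p -> p <= ps.
  move=> [/andP[p0 p1] tp]; rewrite leNgt; apply/negP => psp.
  by have := above p psp p1; rewrite tp ltxx.
have Sj j : S (Num.max 0 (ps - j.+1%:R^-1)).
  split; last exact: below.
  rewrite le_max lexx /= ge_max ler01 /=.
  by rewrite lerBlDr (le_trans (ltW s1)) // lerDl invr_ge0 ler0n.
apply/eqP; rewrite eq_le; apply/andP; split.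
  by apply: ge_sup; [exists (Num.max 0 (ps - 1%:R^-1)); exact: (Sj 0%N)|].
rewrite leNgt; apply/negP => /ltr_add_invr[j Hj].
have : Num.max 0 (ps - j.+1%:R^-1) <= sup S by apply: ub_le_sup; [exists ps|exact: Sj].
by rewrite ge_max => /andP[_]; rewrite leNgt ltrBrDr Hj.
Qed.

Theorem theorem6p2 (R : realType) (G1 : ograph)
    (hdist : (1 < gdist (@oadj G1) (osrc G1) (otgt G1))%N)
    (hpaths : two_edge_disjoint_paths G1)
    (mu : probability (borel_rspace R) R) (hmu : is_BS_limit G1 mu) :
  exists pstar : R,
    [/\ 0 < pstar < 1,
        crossing_prob G1 pstar = pstar,
        forall q : R, 0 < q < 1 -> crossing_prob G1 q = q -> q = pstar &
        {ae mu, forall g : borel_rspace R, pc g = pstar}].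
Proof.
have nc : ~~ oadj (osrc G1) (otgt G1).
  apply/negP => st; have : walk (@oadj G1) (osrc G1) (otgt G1) [:: otgt G1].
    by rewrite /walk /= st eqxx.
  by move/gdist_le; rewrite leqNgt hdist.
have [ps [ps01 fps]] := pstar_exists R nc hpaths; have /andP[s0 s1] := ps01.
exists ps; split => // [q q01 fq|].
  exact: (pstar_unique nc hpaths q01 ps01 fq fps).
pose pj j : R := Num.max 0 (ps - j.+1%:R^-1).
have pjP j : 0 <= pj j /\ pj j < ps.
  have h : 0 < j.+1%:R^-1 :> R by rewrite invr_gt0 ltr0n.
  by split; rewrite /pj ?le_max ?lexx // gt_max s0 /= ltrBlDr ltrDl.
have pj01 j : 0 <= pj j <= 1 by have [-> h] := pjP j; rewrite ltW // (lt_trans h).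
(* [theta_ball] bounds [theta] from above, and its infimum over the radii
   vanishes. *)
have below : {ae mu, forall x : borel_rspace R, forall j k,
    exists r, theta_ball (rrepr (x : rspace R)) r (pj j) < k.+1%:R^-1}.
  apply: ae_foralln => j; apply: ae_foralln => k.
  apply: (BS_ae_small hmu (F := fun r g => theta_ball g r (pj j)) (rho := succn)).
  - by move=> r g h; exact: theta_ball_iso.
  - by move=> r g; exact: theta_ball01.
  - move=> d d0; have [p0 pps] := pjP j.
    have [r [N HN]] := escapes_upper_bound nc hpaths ps01 fps p0 pps d0.
    exists r, N => n /HN; rewrite [X in X / _](_ : _ =
      \sum_(e : oedge (hier G1 n)) theta_ball (rooted e) r (pj j)) //.
    by apply: eq_bigr => e _; rewrite theta_ball_rooted.
  - by rewrite invr_gt0 ltr0n.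
(* All the balls of the limit occur in finite graphs of arbitrarily large index. *)
have above : {ae mu, forall x : borel_rspace R, forall r N, exists n,
    exists2 e : oedge (hier G1 n), (N <= n)%N & riso_ball r (rrepr (x : rspace R)) (rooted e)}.
  apply: ae_foralln => r; apply: ae_foralln => N.
  apply: (BS_ae_local nc hmu (r := r) (N := N) (P := fun g => exists n,
    exists2 e : oedge (hier G1 n), (N <= n)%N & riso_ball r g (rooted e))).
  - move=> g h gh; apply/propext; split => -[n [e Nn ge]]; exists n, e => //.
      exact: riso_ball_trans (riso_ball_sym gh) ge.
    exact: riso_ball_trans gh ge.
  - move=> n Nn e; exists n, e => //; apply: riso_riso_ball; exact: riso_refl.
apply: filterS2 below above => x below above; apply: critical_prob_eq => //.
  move=> j; apply/eqP; rewrite eq_le measure_ge0 andbT.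
  apply/lee_addgt0Pr => d d0; rewrite add0e.
  have [k] := ltr_add_invr d0; rewrite add0r => kd.
  have [r rk] := below j k; apply: le_trans (theta_le_ball _ r (pj01 j)) _.
  by rewrite lee_fin ltW // (lt_trans rk).
move=> p psp p1; have p01 : 0 <= p <= 1 by rewrite p1 ltW // (lt_trans s0).
have [c c0 [N HN]] := joins_lower_bound nc hpaths ps01 fps psp p1.
apply: (@lt_le_trans _ _ c%:E); first by rewrite lte_fin.
apply: theta_ge => // r.
have [n [e Nn xe]] := above r.+1 (maxn N (2 * r + 2)).
rewrite (theta_ball_iso p01 xe) theta_ball_rooted //.
apply: le_trans (HN n _ e) _; first by apply: leq_trans Nn; exact: leq_maxl.
have [phi pot] := hier_potential nc n.
apply: Pr_le => // w; apply: joins_escapes pot _.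
by apply: leq_ltn_trans (ltn_expl n _) => //; apply: leq_trans Nn; exact: leq_maxr.
Qed.
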